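(* Let $\mathbf{k}=\mathbb{Z}/2$ and let $A$ be a symmetric commutative DG open Frobenius $\mathbf{k}$-algebra of degree $m$. Then the shifted relative Hochschild homology $\widetilde{HH}_*(A)[m-1]$ is a BV-algebra whose BV-operator is the Connes operator and whose product is given, for $x=a_0[a_1,\dots,a_p]$ and $y=b_0[b_1,\dots,b_q]$ in $\widetilde C_*(A)$, by $$x\cdot y=\sum_{(a_0b_0)}(a_0b_0)'[a_1,\dots,a_p,(a_0b_0)'',b_1,\dots,b_q]=\sum_{(a_0)}a_0'[a_1,\dots,a_p,a_0''b_0,b_1,\dots,b_q]=\sum_{(b_0)}a_0b_0'[a_1,\dots,a_p,b_0'',b_1,\dots,b_q].$$
   Context: Everything is over $\mathbf{k}=\mathbb{Z}/2$, so signs are omitted. Shift convention: $V[r]_j=V_{j-r}$. **Open Frobenius algebras.** A DG open Frobenius algebra of degree $m$ is a triple $(A,\cdot,\delta)$ where $(A,\cdot)$ is a unital (augmented) DG associative algebra with product of degree $0$, $\delta:A\to A\otimes A$, $\delta x=\sum_{(x)}x'\otimes x''$, is a coassociative chain map of degree $m$, and $\delta$ is a map of left and right $A$-modules: $\sum(xy)'\otimes(xy)''=\sum xy'\otimes y''=\sum x'\otimes x''y$. It is symmetric if $\sum_{(1)}1'\otimes1''=\sum_{(1)}1''\otimes1'$, and commutative if the product is graded commutative. **Relative Hochschild homology.** $\bar A$ is the kernel of the augmentation, identified with $A/\mathbf{k}$ (entries inside brackets are taken in $A/\mathbf{k}$). $C_*(A,A)=\bigoplus_{n\ge0}A\otimes(s\bar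 A)^{\otimes n}$ is the normalized Hochschild chain complex, $a_0[a_1,\dots,a_n]$ having degree $\sum_{i\ge 0}|a_i|-n$. For commutative $A$, the relative Hochschild complex is $\widetilde C_*(A)=\bigoplus_{n\ge1}A\otimes\bar A^{\otimes n}$ with the Hochschild differential; it is the quotient of $C_*(A,A)$ by $(A,d_A)$ (in a split short exact sequence of complexes). Its homology is $\widetilde{HH}_*(A)$. The Connes operator is $B(a_0[a_1,\dots,a_n])=\sum_{i=1}^{n+1}1[a_i,\dots,a_n,a_0,\dots,a_{i-1}]$. **BV-algebra.** A graded commutative associative algebra (not required to be unital) with an operator $\Delta$ of degree $\pm1$ (depending on grading conventions) such that $\Delta^2=0$ and $\Delta(abc)=\Delta(ab)c+a\Delta(bc)+b\Delta(ac)+\Delta(a)bc+a\Delta(b)c+ab\Delta(c)$. *)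

(* Defs.v *)
From HB Require Import structures.
From mathcomp Require Import all_boot all_order all_algebra.
From mathcomp Require Import generic_quotient ring_quotient.
From mathcomp Require Import boolp.
From mathcomp Require Import freeg.

Set Implicit Arguments.
Unset Strict Implicit.
Unset Printing Implicit Defensive.

Import GRing.Theory.
Local Open Scope ring_scope.
Local Open Scope quotient_scope.

Section Span.
Variables (K : nzRingType) (V : lmodType K) (G : V -> Prop).

Inductive lspan : V -> Prop :=
| lspan_zero : lspan 0
| lspan_step c u v : G u -> lspan v -> lspan (c *: u + v).

Lemma lspan_gen u : G u -> lspan u.
Proof. by move=> Gu; rewrite -[u]addr0 -[u]scale1r; apply: lspan_step => //; exact: lspan_zero. Qed.

Lemma lspan_submod : submod_closed [pred v | `[< lspan v >]].
Proof.
split=> [|c u v]; first by apply/asboolP; exact: lspan_zero.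
move=> /asboolP su /asboolP sv; apply/asboolP.
elim: su => [|b w w' Gw _ IH]; first by rewrite scaler0 add0r.
by rewrite scalerDr scalerA -addrA; exact: lspan_step.
Qed.

Definition lspanb : {pred V} := fun v => `[< lspan v >].

HB.instance Definition _ := GRing.isSubmodClosed.Build K V lspanb lspan_submod.

End Span.

(* V modulo the submodule spanned by G. *)
Section QuotientModule.
Variables (K : nzRingType) (V : lmodType K) (G : V -> Prop).

Definition modq := Quotient.quot (lspanb G).

HB.instance Definition _ := GRing.Zmodule.on modq.
HB.instance Definition _ := Quotient.on modq.

Definition to_modq (v : V) : modq := \pi_(Quotient.quot (lspanb G)) v.

Lemma to_modq_eqP (u v : V) : (to_modq u = to_modq v) <-> lspan G (u - v).
Proof.
rewrite /to_modq; split=> [|s].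
  by move/eqP; rewrite -Quotient.idealrBE => /asboolP.
by apply/eqP; rewrite -Quotient.idealrBE; apply/asboolP.
Qed.

Lemma to_modqK (x : modq) : to_modq (repr x) = x.
Proof. exact: reprK. Qed.

Definition modq_scale (c : K) (x : modq) : modq := to_modq (c *: repr x).

Lemma to_modqD (u v : V) : to_modq (u + v) = to_modq u + to_modq v.
Proof. by rewrite /to_modq -[RHS]/(Quotient.add _ _) Quotient.pi_add. Qed.

Lemma to_modq_scale (c : K) (v : V) : to_modq (c *: v) = modq_scale c (to_modq v).
Proof.
apply/to_modq_eqP; rewrite -scalerBr; apply/asboolP.
apply: (@rpredZ K V (lspanb G)); apply/asboolP; apply/to_modq_eqP.
by rewrite to_modqK.
Qed.

Fact modq_scaleA a b x : modq_scale a (modq_scale b x) = modq_scale (a * b) x.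
Proof. by rewrite -[x]to_modqK -!to_modq_scale scalerA. Qed.

Fact modq_scale1 : left_id 1 modq_scale.
Proof. by move=> x; rewrite -[x]to_modqK -!to_modq_scale scale1r. Qed.

Fact modq_scaleDr : right_distributive modq_scale +%R.
Proof.
move=> a x y; rewrite -[x]to_modqK -[y]to_modqK -to_modqD -!to_modq_scale.
by rewrite -to_modqD scalerDr.
Qed.

Fact modq_scaleDl x : {morph modq_scale^~ x : a b / a + b}.
Proof.
by move=> a b; rewrite -[x]to_modqK -!to_modq_scale -to_modqD scalerDl.
Qed.

HB.instance Definition _ := GRing.Zmodule_isLmodule.Build K modq
  modq_scaleA modq_scale1 modq_scaleDr modq_scaleDl.

Fact to_modq_linear : linear to_modq.
Proof. by move=> c u v; rewrite to_modqD to_modq_scale. Qed.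

HB.instance Definition _ := GRing.isLinear.Build K V modq *:%R to_modq to_modq_linear.

End QuotientModule.

(* The K-module with generators X and relations rel. *)
Section PresentedModule.
Variables (K : nzRingType) (X : choiceType) (rel : {freeg X / K} -> Prop).

Definition presented := modq rel.

HB.instance Definition _ := GRing.Lmodule.on presented.

Definition pgen (x : X) : presented := to_modq rel << x >>.

Variables (W : lmodType K) (f : X -> W).

HB.instance Definition _ := GRing.isZmodMorphism.Build {freeg X / K} W
  (fglift f) (@lift_is_additive K X W f).

Fact fglift_scalable : scalable (fglift f).
Proof.
move=> c D; have -> : fglift f D = \sum_(x <- dom D) coeff x D *: f x.
  rewrite -[in LHS](freeg_sumE D) raddf_sum.
  by apply: eq_bigr => x _ /=; rewrite liftU.
rewrite -[c *: D]/(fgscale c D) /fgscale raddf_sum scaler_sumr.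
by apply: eq_bigr => x _ /=; rewrite liftU scalerA.
Qed.

HB.instance Definition _ := GRing.isScalable.Build K {freeg X / K} W *:%R
  (fglift f) fglift_scalable.

(* The linear extension of f; it is the induced map only when f respects the
   relations, see plift_linear and plift_pgen. *)
Definition plift (p : presented) : W := fglift f (repr (p : modq rel)).

Hypothesis f_rel : forall r, rel r -> fglift f r = 0.

Lemma plift_to_modq D : plift (to_modq rel D) = fglift f D.
Proof.
have fs r : lspan rel r -> fglift f r = 0.
  elim=> [|c u v /f_rel fu _ fv]; first exact: raddf0.
  by rewrite linearP /= fu fv scaler0 addr0.
apply/eqP; rewrite -subr_eq0 -raddfB; apply/eqP/fs; apply/to_modq_eqP.
by rewrite to_modqK.
Qed.

Lemma plift_pgen x : plift (pgen x) = f x.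
Proof. by rewrite plift_to_modq liftU scale1r. Qed.

Lemma plift_linear : linear plift.
Proof.
move=> c p q; rewrite -[p]to_modqK -[q]to_modqK -linearP.
by rewrite !plift_to_modq linearP.
Qed.

End PresentedModule.

Section Tensor.
Variables (K : comNzRingType) (U V : lmodType K).

Inductive tensor_rel : {freeg (U * V)%type / K} -> Prop :=
| tensor_rel_l c u u' v :
    tensor_rel (<< (c *: u + u', v) >> - (c *: << (u, v) >> + << (u', v) >>))
| tensor_rel_r u c v v' :
    tensor_rel (<< (u, c *: v + v') >> - (c *: << (u, v) >> + << (u, v') >>)).

Definition tensor := presented tensor_rel.

HB.instance Definition _ := GRing.Lmodule.on tensor.

Definition tens (u : U) (v : V) : tensor := pgen tensor_rel (u, v).

(* The map U (x) V -> W induced by a bilinear f. *)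
Definition tlift (W : lmodType K) (f : U -> V -> W) (x : tensor) : W :=
  plift (fun uv => f uv.1 uv.2) x.

Section TensorLift.
Variables (W : lmodType K) (f : U -> V -> W).
Hypothesis (fl : forall v, linear (f^~ v)) (fr : forall u, linear (f u)).

Fact tlift_rel r : tensor_rel r -> fglift (fun uv => f uv.1 uv.2) r = 0.
Proof.
by case=> [c u u' v|u c v v']; rewrite raddfB /= linearP /= !liftU !scale1r /=
  ?(fl v) ?(fr u) subrr.
Qed.

Lemma tlift_tens u v : tlift f (tens u v) = f u v.
Proof. by rewrite /tlift plift_pgen //; exact: tlift_rel. Qed.

Lemma tlift_linear : linear (tlift f).
Proof. by apply: plift_linear; exact: tlift_rel. Qed.

End TensorLift.
End Tensor.

Section Homology.
Variables (K : nzRingType) (C : lmodType K) (d : {linear C -> C}).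

Definition kerd : {pred C} := fun z => d z == 0.

Fact kerd_submod : submod_closed kerd.
Proof.
split=> [|c u v]; rewrite !unfold_in ?linear0 // linearP => /eqP-> /eqP->.
by rewrite scaler0 addr0.
Qed.

HB.instance Definition _ := GRing.isSubmodClosed.Build K C kerd kerd_submod.

Record dcycle := DCycle { dcycle_val : C; _ : dcycle_val \in kerd }.

HB.instance Definition _ := [isSub for dcycle_val].
HB.instance Definition _ := [Choice of dcycle by <:].
HB.instance Definition _ := [SubChoice_isSubLmodule of dcycle by <:].

Definition boundary (z : dcycle) : Prop := exists c : C, dcycle_val z = d c.

Definition homology := modq boundary.

HB.instance Definition _ := GRing.Lmodule.on homology.

Definition hclass (z : dcycle) : homology := to_modq boundary z.

End Homology.

Section Graded.
Variable V : lmodType 'F_2.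
Implicit Type gr : int -> V -> Prop.

(* V is the internal direct sum of the submodules gr i. *)
Definition graded gr : Prop :=
  [/\ forall i, gr i 0,
      forall i c u v, gr i u -> gr i v -> gr i (c *: u + v),
      forall v, exists (s : seq int) (f : int -> V),
        (forall i, gr i (f i)) /\ v = \sum_(i <- s) f i
    & forall (s : seq int) (f : int -> V), uniq s -> (forall i, gr i (f i)) ->
        \sum_(i <- s) f i = 0 -> forall i, i \in s -> f i = 0].

(* V[r]_j = V_(j - r) *)
Definition shift_gr gr (r : int) : int -> V -> Prop := fun j => gr (j - r).

End Graded.

Section DGAlgebra.
Variable A : algType 'F_2.

(* Signs are omitted since the ground field has characteristic 2; the
   differential raises degrees by 1, matching |a0[a1,...,an]| = sum |ai| - n. *)
Record dg_algebra := DGAlgebra {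
  gr : int -> A -> Prop;
  gr_graded : graded gr;
  gr_one : gr 0 1;
  gr_mul : forall i j (a b : A), gr i a -> gr j b -> gr (i + j) (a * b);
  diff : {linear A -> A};
  diff_gr : forall i (a : A), gr i a -> gr (i + 1) (diff a);
  diff_diff : forall a : A, diff (diff a) = 0;
  diff_mul : forall a b : A, diff (a * b) = diff a * b + a * diff b;
  aug : {lrmorphism A -> ('F_2)^o};
  aug_gr : forall i (a : A), gr i a -> i != 0 -> aug a = 0;
  aug_diff : forall a : A, aug (diff a) = 0
}.

Implicit Type D : dg_algebra.

Definition tensor_gr D (j : int) : tensor A A -> Prop :=
  lspan (fun x => exists i a b, [/\ gr D i a, gr D (j - i) b & x = tens a b]).

Definition tensor_diff D : tensor A A -> tensor A A :=
  tlift (fun a b => tens (diff D a) b + tens a (diff D b)).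

Definition tensor_assoc : tensor (tensor A A) A -> tensor A (tensor A A) :=
  tlift (fun x c => tlift (fun a b => tens a (tens b c)) x).

Definition tensor_swap : tensor A A -> tensor A A := tlift (fun a b => tens b a).

Record open_frobenius (m : int) := OpenFrobenius {
  frob_dg :> dg_algebra;
  coprod : {linear A -> tensor A A};
  coprod_gr : forall i (a : A), gr frob_dg i a -> tensor_gr frob_dg (i + m) (coprod a);
  coprod_diff : forall a : A, coprod (diff frob_dg a) = tensor_diff frob_dg (coprod a);
  coprod_coassoc : forall a : A,
    tensor_assoc (tlift (fun u v => tens (coprod u) v) (coprod a))
      = tlift (fun u v => tens u (coprod v)) (coprod a);
  coprod_lmod : forall a b : A,
    coprod (a * b) = tlift (fun u v => tens (a * u) v) (coprod b);
  coprod_rmod : forall a b : A,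
    coprod (a * b) = tlift (fun u v => tens u (v * b)) (coprod a)
}.

(* coprod_sum F x f is the Sweedler sum of the f x' x''. *)
Definition coprod_sum m (F : open_frobenius m) (x : A) (W : lmodType 'F_2)
  (f : A -> A -> W) : W := tlift f (coprod F x).

Definition symmetric_frobenius m (F : open_frobenius m) : Prop :=
  tensor_swap (coprod F 1) = coprod F 1.

End DGAlgebra.

Section HochschildChains.
Variable A : algType 'F_2.

(* The pair (a0, [:: a1; ...; an]) stands for a0[a1,...,an]; the n = 0 part is
   killed by chain_rel_nil, and the bracket entries live in A/k by
   chain_rel_unit. *)
Inductive chain_rel : {freeg (A * seq A)%type / 'F_2} -> Prop :=
| chain_rel_nil a : chain_rel << (a, [::]) >>
| chain_rel_head c a b s :
    chain_rel (<< (c *: a + b, s) >> - (c *: << (a, s) >> + << (b, s) >>))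
| chain_rel_slot a s c x y t :
    chain_rel (<< (a, s ++ (c *: x + y) :: t) >>
               - (c *: << (a, s ++ x :: t) >> + << (a, s ++ y :: t) >>))
| chain_rel_unit a s t : chain_rel << (a, s ++ 1 :: t) >>.

Definition rchains := presented chain_rel.

HB.instance Definition _ := GRing.Lmodule.on rchains.

Definition rgen (a0 : A) (s : seq A) : rchains := pgen chain_rel (a0, s).

(* The linear extension of f from words with nonempty brackets. *)
Definition rlift (W : lmodType 'F_2) (f : A -> seq A -> W) (x : rchains) : W :=
  plift (fun w => if nilp w.2 then 0 else f w.1 w.2) x.

Lemma rgen_nil a : rgen a [::] = 0.
Proof.
rewrite -[RHS](raddf0 (to_modq chain_rel)); apply/to_modq_eqP; rewrite subr0.
exact/lspan_gen/chain_rel_nil.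
Qed.

Lemma rgen_unit a s t : rgen a (s ++ 1 :: t) = 0.
Proof.
rewrite -[RHS](raddf0 (to_modq chain_rel)); apply/to_modq_eqP; rewrite subr0.
exact/lspan_gen/chain_rel_unit.
Qed.

Lemma rgen_head s : linear (rgen^~ s).
Proof.
move=> c a b; rewrite /rgen /pgen -(linearP (to_modq chain_rel)); apply/to_modq_eqP.
exact/lspan_gen/chain_rel_head.
Qed.

Lemma rgen_slot a s t : linear (fun x => rgen a (s ++ x :: t)).
Proof.
move=> c x y; rewrite /rgen /pgen -(linearP (to_modq chain_rel)); apply/to_modq_eqP.
exact/lspan_gen/chain_rel_slot.
Qed.

Section RLift.
Variables (W : lmodType 'F_2) (f : A -> seq A -> W).
Hypotheses (f_head : forall s, linear (f^~ s))
           (f_slot : forall a s t, linear (fun x => f a (s ++ x :: t)))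
           (f_unit : forall a s t, f a (s ++ 1 :: t) = 0).

Fact rlift_rel r : chain_rel r ->
  fglift (fun w => if nilp w.2 then 0 else f w.1 w.2) r = 0.
Proof.
case=> [a|c a b s|a s c x y t|a s t].
- by rewrite liftU scale1r.
- rewrite raddfB /= linearP /= !liftU !scale1r /=.
  by case: (nilp s); rewrite ?scaler0 ?addr0 ?subr0 // (f_head s) subrr.
- rewrite raddfB /= linearP /= !liftU !scale1r /= /nilp !size_cat !addnS /=.
  by rewrite (f_slot a s t) subrr.
- by rewrite liftU scale1r /= /nilp size_cat addnS /= f_unit.
Qed.

Lemma rlift_rgen a s : s != [::] -> rlift f (rgen a s) = f a s.
Proof.
by case: s => // b s _; rewrite /rlift plift_pgen //; exact: rlift_rel.
Qed.

Lemma rlift_linear : linear (rlift f).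
Proof. by apply: plift_linear; exact: rlift_rel. Qed.

End RLift.

(* The last three lines are the external differential; for n = 1 its value
   a0 a1[] + a1 a0[] lies in the killed n = 0 part. *)
Definition hoch_word (d : A -> A) (a0 : A) (s : seq A) : rchains :=
    rgen (d a0) s
  + \sum_(i < size s) rgen a0 (take i s ++ d s`_i :: drop i.+1 s)
  + rgen (a0 * s`_0) (behead s)
  + \sum_(i < (size s).-1) rgen a0 (take i s ++ s`_i * s`_i.+1 :: drop i.+2 s)
  + rgen (last 0 s * a0) (take (size s).-1 s).

Definition connes_word (a0 : A) (s : seq A) : rchains :=
  \sum_(i < (size s).+1) rgen 1 (drop i s ++ a0 :: take i s).

Fact linear_fadd (W : lmodType 'F_2) (f g : A -> W) :
  linear f -> linear g -> linear (fun x => f x + g x).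
Proof. by move=> fl gl c x y; rewrite fl gl scalerDr addrACA. Qed.

Fact linear_fsum (W : lmodType 'F_2) n (f : 'I_n -> A -> W) :
  (forall i, linear (f i)) -> linear (fun x => \sum_(i < n) f i x).
Proof.
move=> fl c x y; rewrite scaler_sumr -big_split; apply: eq_bigr => i _.
exact: fl.
Qed.

Fact addrr2 (W : lmodType 'F_2) (x : W) : x + x = 0.
Proof.
rewrite -[x]scale1r -scalerDl.
by rewrite (_ : 1 + 1 = 0 :> 'F_2) ?scale0r //; apply/eqP.
Qed.

Section HochWord.
Variable D : dg_algebra A.
Local Notation d := (diff D).

Fact diff_one : d 1 = 0.
Proof.
have /eqP := diff_mul D 1 1; rewrite !mulr1 mul1r.
by rewrite -subr_eq0 opprD addrA subrr sub0r oppr_eq0 => /eqP.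
Qed.

Fact hoch_head s : linear ((hoch_word d)^~ s).
Proof.
rewrite /hoch_word; do !apply: linear_fadd.
- by move=> c a b; rewrite linearP rgen_head.
- by apply: linear_fsum => i c a b; rewrite rgen_head.
- by move=> c a b; rewrite mulrDl -scalerAl rgen_head.
- by apply: linear_fsum => i c a b; rewrite rgen_head.
- by move=> c a b; rewrite mulrDr -scalerAr rgen_head.
Qed.

Fact dropl_cat i (s w : seq A) : (i <= size s)%N -> drop i (s ++ w) = drop i s ++ w.
Proof.
rewrite leq_eqVlt => /predU1P[->|lt_is]; last by rewrite drop_cat lt_is.
by rewrite drop_size_cat // drop_size.
Qed.

Fact slot_after j (s t : seq A) x :
  ((take (size s + j.+1) (s ++ x :: t) = s ++ x :: take j t)
  * (drop (size s + j.+1) (s ++ x :: t) = drop j t)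
  * ((s ++ x :: t)`_(size s + j.+1) = t`_j))%type.
Proof. by rewrite take_cat drop_cat nth_cat ltnNge leq_addr /= addKn. Qed.

Fact slot_after1 j (s t : seq A) x :
  ((drop (size s + j.+1).+1 (s ++ x :: t) = drop j.+1 t)
  * (drop (size s + j.+1).+2 (s ++ x :: t) = drop j.+2 t)
  * ((s ++ x :: t)`_(size s + j.+1).+1 = t`_j.+1))%type.
Proof. by rewrite -!addnS !slot_after. Qed.

Fact slot_at (s t : seq A) x :
  ((take (size s) (s ++ x :: t) = s)
  * (drop (size s).+1 (s ++ x :: t) = t)
  * (drop (size s).+2 (s ++ x :: t) = drop 1 t)
  * ((s ++ x :: t)`_(size s) = x)
  * ((s ++ x :: t)`_(size s).+1 = t`_0))%type.
Proof.
have nthE : (s ++ x :: t)`_(size s) = x by rewrite nth_cat ltnn subnn.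
by rewrite take_size_cat // nthE -(addn1 (size s)) -addnS !slot_after drop0.
Qed.

Fact slotP (s : seq A) i :
  [\/ (i < size s)%N, i = size s | exists j, i = (size s + j.+1)%N].
Proof.
case: (ltngtP i (size s)) => [lt_is|lt_si|eq_is].
- by constructor 1.
- by constructor 3; exists (i - (size s).+1)%N; rewrite addnS -addSn subnKC.
- by constructor 2.
Qed.

Fact diff_slot a s t i : linear (fun x => let w := s ++ x :: t in
  rgen a (take i w ++ d w`_i :: drop i.+1 w)).
Proof.
move=> c x y /=; case: (slotP s i) => [lt_is|->|[j ->]].
- rewrite !takel_cat ?(ltnW lt_is) // !dropl_cat // !nth_cat lt_is.
  by rewrite -!cat_cons !catA rgen_slot.
- by rewrite !slot_at linearP rgen_slot.
- by rewrite !slot_after !slot_after1 -!catA /= rgen_slot.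
Qed.

Fact merge_slot a s t i : linear (fun x => let w := s ++ x :: t in
  rgen a (take i w ++ w`_i * w`_i.+1 :: drop i.+2 w)).
Proof.
move=> c x y /=; case: (slotP s i) => [lt_is|->|[j ->]].
- rewrite !takel_cat ?(ltnW lt_is) //; move: (lt_is).
  rewrite leq_eqVlt => /predU1P[eq_is|lt_i1s].
    by rewrite eq_is !slot_at !nth_cat lt_is mulrDr -scalerAr rgen_slot.
  by rewrite !dropl_cat // !nth_cat lt_is lt_i1s -!cat_cons !catA rgen_slot.
- by rewrite !slot_at mulrDl -scalerAl rgen_slot.
- by rewrite !slot_after !slot_after1 -!catA /= rgen_slot.
Qed.

Fact hoch_slot a s t : linear (fun x => hoch_word d a (s ++ x :: t)).
Proof.
have sizeE x : size (s ++ x :: t) = (size s + size t).+1.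
  by rewrite size_cat addnS.
rewrite (_ : (fun x => _) = fun x => let w := s ++ x :: t in
      rgen (d a) w
    + \sum_(i < (size s + size t).+1) rgen a (take i w ++ d w`_i :: drop i.+1 w)
    + rgen (a * w`_0) (behead w)
    + \sum_(i < size s + size t) rgen a (take i w ++ w`_i * w`_i.+1 :: drop i.+2 w)
    + rgen (last 0 w * a) (take (size s + size t) w)); last first.
  by apply: funext => x; rewrite /hoch_word sizeE.
do !apply: linear_fadd.
- exact: rgen_slot.
- by apply: linear_fsum => i; exact: diff_slot.
- case: s {sizeE} => [|b s] c x y /=; last by rewrite rgen_slot.
  by rewrite mulrDr -scalerAr rgen_head.
- by apply: linear_fsum => i; exact: merge_slot.
- case/lastP: t {sizeE} => [|t b] c x y.
    by rewrite addn0 !take_size_cat // !last_cat /= mulrDl -scalerAl rgen_head.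
  rewrite !last_cat /= !last_rcons size_rcons !addnS !take_cat !ltnNge.
  by rewrite !leqW ?leq_addr //= -addnS !addKn /= -cats1 !take_size_cat // rgen_slot.
Qed.

Fact merge_unit a s t i : (i < size s + size t)%N ->
  let w := s ++ 1 :: t in
  rgen a (take i w ++ w`_i * w`_i.+1 :: drop i.+2 w) =
    (if i.+1 == size s then rgen a (s ++ t) else 0) +
    (if i == size s then rgen a (s ++ t) else 0).
Proof.
move=> lt_i /=; move: lt_i; case: (slotP s i) => [lt_is|->|[j ->]] lt_i.
- rewrite (ltn_eqF lt_is) addr0 takel_cat ?(ltnW lt_is) //; case: ifP => [/eqP eq_is|ne].
    rewrite eq_is !slot_at !nth_cat lt_is mulr1 -cat_rcons -take_nth //.
    by rewrite eq_is take_size.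
  have lt_i1s : (i.+1 < size s)%N by rewrite ltn_neqAle ne.
  by rewrite dropl_cat // -cat_cons catA rgen_unit.
- rewrite eqxx gtn_eqF // add0r !slot_at mul1r; congr rgen; congr (_ ++ _).
  by case: t lt_i => [|b t] /=; rewrite ?addn0 ?ltnn ?drop0.
- rewrite !gtn_eqF ?addr0 ?addnS ?ltnS ?leqW ?leq_addr // -addnS.
  by rewrite !slot_after !slot_after1 -catA /= rgen_unit.
Qed.

Fact sum_ord_pred1 (W : lmodType 'F_2) (e : W) n m :
  \sum_(i < n) (if val i == m then e else 0) = if (m < n)%N then e else 0.
Proof.
case: ltnP => [lt_mn|le_nm].
  by rewrite -big_mkcond (big_pred1 (Ordinal lt_mn)).
by rewrite big1 // => i _; rewrite ltn_eqF // (leq_trans (ltn_ord i)).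
Qed.

Fact hoch_unit a s t : hoch_word d a (s ++ 1 :: t) = 0.
Proof.
rewrite /hoch_word rgen_unit add0r size_cat addnS [X in X + _ + _ + _]big1.
  rewrite add0r (eq_bigr _ (fun i _ => merge_unit a (ltn_ord i))) big_split /=.
  rewrite sum_ord_pred1.
  have -> : \sum_(i < size s + size t)
      (if i.+1 == size s then rgen a (s ++ t) else 0) =
      if s is [::] then 0 else rgen a (s ++ t).
    case: s => [|b s] /=; first by rewrite big1.
    by rewrite sum_ord_pred1 addSn ltnS leq_addr.
  rewrite -[X in (X < _)%N]addn0 ltn_add2l.
  have -> : rgen (a * (s ++ 1 :: t)`_0) (behead (s ++ 1 :: t)) =
      if s is [::] then rgen a (s ++ t) else 0.
    by case: s => [|b s] /=; rewrite ?mulr1 ?rgen_unit.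
  have -> : rgen (last 0 (s ++ 1 :: t) * a) (take (size s + size t) (s ++ 1 :: t))
      = if t is [::] then rgen a (s ++ t) else 0.
    case/lastP: t => [|t b]; first by rewrite addn0 last_cat take_size_cat //= mul1r cats0.
    rewrite size_rcons addnS -addnS slot_after -cats1 take_size_cat // rgen_unit.
    by case: t.
  by case: s => [|b s]; case: t => [|c t] /=; rewrite ?addr0 ?add0r ?addrr2.
move=> i _; case: (slotP s i) => [lt_is|->|[j ->]].
- rewrite takel_cat ?(ltnW lt_is) // dropl_cat //.
  by rewrite -cat_cons catA rgen_unit.
- rewrite !slot_at diff_one.
  have := rgen_slot a s t 1 0 0.
  by rewrite /= !scale1r addr0 addrr2.
- by rewrite !slot_after !slot_after1 -catA /= rgen_unit.
Qed.

End HochWord.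

Fact connes_head s : linear (connes_word^~ s).
Proof. by apply: linear_fsum => i c a b; rewrite rgen_slot. Qed.

Fact connes_slot a s t : linear (fun x => connes_word a (s ++ x :: t)).
Proof.
have sizeE x : size (s ++ x :: t) = (size s + size t).+1.
  by rewrite size_cat addnS.
rewrite (_ : (fun x => _) = fun x => let w := s ++ x :: t in
    \sum_(i < (size s + size t).+2) rgen 1 (drop i w ++ a :: take i w)).
  apply: linear_fsum => i c x y /=; case: (slotP s i) => [lt_is|->|[j ->]].
  - rewrite !takel_cat ?(ltnW lt_is) // !dropl_cat ?(ltnW lt_is) //.
    by rewrite -!catA /= rgen_slot.
  - by rewrite !take_size_cat // !drop_size_cat //= -(cat0s (_ :: _)) rgen_slot.
  - by rewrite !slot_after -!cat_cons !catA rgen_slot.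
by apply: funext => x; rewrite /connes_word sizeE.
Qed.

Fact connes_unit a s t : connes_word a (s ++ 1 :: t) = 0.
Proof.
rewrite /connes_word big1 // => i _; case: (slotP s i) => [lt_is|->|[j ->]].
- rewrite takel_cat ?(ltnW lt_is) // dropl_cat ?(ltnW lt_is) //.
  by rewrite -catA /= rgen_unit.
- by rewrite take_size_cat // drop_size_cat //= -(cat0s (_ :: _)) rgen_unit.
- by rewrite !slot_after -[RHS](rgen_unit 1 (drop j t ++ a :: s) (take j t)) -catA.
Qed.

Definition hochD (D : dg_algebra A) : rchains -> rchains :=
  rlift (hoch_word (diff D)).

Lemma hochD_rgen D a s : s != [::] -> hochD D (rgen a s) = hoch_word (diff D) a s.
Proof.
by apply: rlift_rgen; [exact: hoch_head|exact: hoch_slot|exact: hoch_unit].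
Qed.

Fact hochD_linear D : linear (hochD D).
Proof.
by apply: rlift_linear; [exact: hoch_head|exact: hoch_slot|exact: hoch_unit].
Qed.

HB.instance Definition _ D :=
  GRing.isLinear.Build 'F_2 rchains rchains *:%R (hochD D) (hochD_linear D).

Definition connes : rchains -> rchains := rlift connes_word.

Lemma connes_rgen a s : s != [::] -> connes (rgen a s) = connes_word a s.
Proof.
by apply: rlift_rgen; [exact: connes_head|exact: connes_slot|exact: connes_unit].
Qed.

Fact connes_linear : linear connes.
Proof.
by apply: rlift_linear; [exact: connes_head|exact: connes_slot|exact: connes_unit].
Qed.

HB.instance Definition _ :=
  GRing.isLinear.Build 'F_2 rchains rchains *:%R connes connes_linear.

Definition rchains_gr (D : dg_algebra A) (j : int) : rchains -> Prop :=
  lspan (fun x => exists (a : A) (s : seq A) (i0 : int) (i : nat -> int),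
    [/\ gr D i0 a, forall l, (l < size s)%N -> gr D (i l) s`_l,
        j = i0 + \sum_(l < size s) i l - (size s)%:Z & x = rgen a s]).

Definition HH (D : dg_algebra A) := homology (hochD D).

HB.instance Definition _ D := GRing.Lmodule.on (HH D).

Definition HH_gr (D : dg_algebra A) (j : int) (h : HH D) : Prop :=
  exists z : dcycle (hochD D), rchains_gr D j (dcycle_val z) /\ h = hclass z.

Definition rprod_word m (F : open_frobenius A m) a0 s b0 t : rchains :=
  coprod_sum F (a0 * b0) (fun u v => rgen u (s ++ v :: t)).

Definition rprod m (F : open_frobenius A m) (x y : rchains) : rchains :=
  rlift (fun a0 s => rlift (fun b0 t => rprod_word F a0 s b0 t) y) x.

End HochschildChains.

Record BV_algebra (V : lmodType 'F_2) (grV : int -> V -> Prop)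
    (mul : V -> V -> V) (Delta : V -> V) (e : int) : Prop := BVAlgebra {
  BV_graded : graded grV;
  BV_mul_linearl : forall y, linear (mul^~ y);
  BV_mul_linearr : forall x, linear (mul x);
  BV_mul_gr : forall i j x y, grV i x -> grV j y -> grV (i + j) (mul x y);
  BV_mulA : associative mul;
  BV_mulC : commutative mul;
  BV_Delta_linear : linear Delta;
  BV_deg : e = 1 \/ e = -1;
  BV_Delta_gr : forall i x, grV i x -> grV (i + e) (Delta x);
  BV_Delta2 : forall x, Delta (Delta x) = 0;
  BV_rel : forall a b c,
    Delta (mul (mul a b) c) =
      mul (Delta (mul a b)) c + mul a (Delta (mul b c)) + mul b (Delta (mul a c))
      + mul (mul (Delta a) b) c + mul (mul a (Delta b)) c + mul (mul a b) (Delta c)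
}.

(* Main.v *)
(* Write the coproduct of 1 as a sum of tensors e (x) f. Then x y is the sum of
   the a0 b0 e[a1,...,ap,f,b1,...,bq], and the Casimir identity, z e (x) f =
   e (x) z f, makes [a0 e,a1,...,ap,f] behave as a block: spliced into a word,
   its two ends absorb their neighbours in the same way, and the differential
   inside the block is the Hochschild differential of x. So the product is an
   associative chain map, and in the splicing operations below the merges at the
   two ends of a block telescope, only extremal terms surviving.
   - K(x,y) splices the block of x into all gaps of the cyclic word y; its
     boundary is x y + y x, so the product commutes on homology.
   - H(x,y), the sum of the rotations of K(x,y) behind a unit which start after
     the block, is a homotopy from K(x,y) to B(y) x plus half of B(x y); adding
     H(y,x) gives B(x y) + B(x) y + B(y) x ~ K(x,y) + K(y,x).
   - K(z,x y) = K(z,x) y + x K(z,y) on the nose, and splicing in two blocks is a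
     homotopy from K(x y,z) to x K(y,z) + K(x,z) y.
   Hence the bracket B(x y) + B(x) y + x B(y) is a derivation in each variable,
   which is the BV relation. *)

(* All operations are first functions of words, linear in each letter and zero on a unit in the
   bracket; their composites with the differential are computed by recursion on lists, and only then
   lifted to chains. Such a function may be nonzero on an empty bracket although chains with empty
   bracket vanish. This is harmless: the two terms of the differential that empty a one-letter
   bracket are equal by commutativity of [A] and cancel.

   The relative complex is what makes a block behave. Around an empty word the two halves of the
   Casimir element would be adjacent, and the differential would merge them into the product e f,
   which need not vanish. Hence the hypotheses [s != [::]] in every boundary formula.

   On cycles, K(x,y) has the commutator as boundary, so only K(x,y) + K(y,x) defines a class, the
   one that represents the bracket. In the bracket of x y with z both orders occur: K(z,x y) is
   governed by the exact rule and K(x y,z) by the homotopy with two blocks. Neither rule suffices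
   alone. *)
From HB Require Import structures.
Require Import Defs.
From mathcomp Require Import all_boot all_order all_algebra.
From mathcomp Require Import boolp freeg zify.

Set Implicit Arguments.
Unset Strict Implicit.
Unset Printing Implicit Defensive.

Import GRing.Theory.
Local Open Scope ring_scope.

(** * Sums in characteristic two *)

Section CharTwo.
Variable W : lmodType 'F_2.
Implicit Types x y z : W.

Lemma oppr2 x : - x = x.
Proof. by apply/eqP; rewrite -subr_eq0 -opprD oppr_eq0 addrr2. Qed.

Lemma subr2 x y : x - y = x + y.
Proof. by rewrite oppr2. Qed.

Lemma eq_addr2 x y : x + y = 0 <-> x = y.
Proof. by rewrite -{1}(oppr2 y); split=> [/eqP|->]; rewrite ?subrr // subr_eq0 => /eqP. Qed.

Lemma eq_of_add2 x y : x + y = 0 -> x = y.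
Proof. by move/eq_addr2. Qed.

Lemma add2_of_eq x y : x = y -> x + y = 0.
Proof. by move/eq_addr2. Qed.

Lemma char2_cancel x y z : x = y -> x + z = y + z.
Proof. by move=> ->. Qed.

Lemma char2_move x y z t : x = t + y + z -> x + y = t + z.
Proof. by move=> ->; rewrite addrAC -(addrA t) addrr2 addr0. Qed.

Lemma char2_cancel1 x z : x = 0 -> x + z = z.
Proof. by move=> ->; rewrite add0r. Qed.

Lemma char2_cancel2 x z : x = 0 -> z = x + z.
Proof. by move=> ->; rewrite add0r. Qed.

Lemma char2_back x y z : x + z = y -> x = y + z.
Proof. by move=> <-; rewrite -addrA addrr2 addr0. Qed.

Lemma char2_move1 x y z : x = y + z -> x + y = z.
Proof. by move=> ->; rewrite addrAC addrr2 add0r. Qed.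

End CharTwo.

(* Proves an identity between sums in which every term occurs an even number
   of times in total; syntactic equality of terms is tried before conversion. *)
Ltac char2_last same :=
  lazymatch goal with
  | |- _ + ?y = _ + ?z => tryif same y z then apply: char2_cancel
      else (apply: char2_move; char2_last same)
  | |- _ + ?y = ?z => tryif same y z then apply: char2_cancel1
      else (apply: char2_move1; char2_last same)
  | |- ?y = _ + ?z => same y z; apply: char2_cancel2
  | |- ?y = ?z => same y z; reflexivity
  end.
Ltac char2_same y z := constr_eq y z.
Ltac char2_unify y z := unify y z.
Ltac char2_collect :=
  lazymatch goal with
  | |- _ = 0 => idtac
  | |- _ = _ + _ => apply: char2_back; char2_collect
  | |- _ => apply: eq_of_add2
  end.
Ltac char2 :=
  apply: eq_of_add2; rewrite ?addr0 ?add0r ?addrA;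
  repeat (lazymatch goal with
  | |- 0 = 0 => reflexivity
  | |- _ + _ = 0 => apply: add2_of_eq;
      first [char2_last char2_same | char2_last char2_unify];
      try char2_collect
  end).

(** * The Hochschild differential on functions of words *)

Section Splits.
Variables (T : Type) (W : lmodType 'F_2).
Implicit Types (t : seq T) (phi : seq T -> seq T -> W).

(** Cuts are listed by recursion, not by position, so that a sum over cuts is handled by induction
    on the word with the first letter moved into the summand. *)
Fixpoint splits t : seq (seq T * seq T) :=
  if t is y :: t' then ([::], t) :: [seq (y :: p.1, p.2) | p <- splits t']
  else [:: ([::], [::])].

Arguments splits : simpl never.

Lemma sum_splits0 phi : \sum_(p <- splits [::]) phi p.1 p.2 = phi [::] [::].
Proof. by rewrite big_seq1. Qed.

Lemma sum_splits_cons phi y t : \sum_(p <- splits (y :: t)) phi p.1 p.2 =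
  phi [::] (y :: t) + \sum_(p <- splits t) phi (y :: p.1) p.2.
Proof. by rewrite big_cons big_map. Qed.

Lemma sum_splits_cat phi s x t : \sum_(p <- splits (s ++ x :: t)) phi p.1 p.2 =
  \sum_(p <- splits s) phi p.1 (p.2 ++ x :: t)
  + \sum_(p <- splits t) phi (s ++ x :: p.1) p.2.
Proof.
elim: s phi => [|y s IH] phi; first by rewrite sum_splits_cons big_seq1.
rewrite cat_cons sum_splits_cons.
rewrite (sum_splits_cons (fun u v => phi u (v ++ x :: t))).
by rewrite (IH (fun u => phi (y :: u))) addrA.
Qed.

(** Coassociativity of deconcatenation: both sides run over the cuts of [t] into three pieces. *)
Lemma sum_splits_assoc (phi : seq T -> seq T -> seq T -> W) t :
  \sum_(p <- splits t) \sum_(q <- splits p.1) phi q.1 q.2 p.2 =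
  \sum_(p <- splits t) \sum_(q <- splits p.2) phi p.1 q.1 q.2.
Proof.
elim: t phi => [|y t IH] phi; first by rewrite !big_seq1 /= ?big_seq1.
rewrite (sum_splits_cons (fun u v => \sum_(q <- splits u) phi q.1 q.2 v)).
rewrite (sum_splits_cons (fun u v => \sum_(q <- splits v) phi u q.1 q.2)).
rewrite /= big_seq1 big_cons big_map /= -addrA -(IH (fun u => phi (y :: u))).
rewrite -big_split /=; congr (_ + _); apply: eq_bigr => p _.
by rewrite (sum_splits_cons (fun u v => phi u v p.2)).
Qed.

(** Moving the cut past one letter turns an [l] term into an [r] term, so these cancel in pairs and
    the two extreme cuts remain. In most uses [l] and [r] are the merges at the two ends of a block
    placed at the cut, and the hypothesis is the Casimir identity. *)
Lemma sum_splits_telescope (l r : seq T -> seq T -> W) t :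
    (forall u z v, l (rcons u z) v = r u (z :: v)) ->
  \sum_(p <- splits t) (l p.1 p.2 + r p.1 p.2) = l [::] t + r t [::].
Proof.
elim: t l r => [|y t IH] l r lr; first by rewrite big_seq1.
rewrite (sum_splits_cons (fun u v => l u v + r u v)).
rewrite (IH (fun u => l (y :: u)) (fun u => r (y :: u))); last first.
  by move=> u z v; rewrite -rcons_cons lr.
rewrite (lr [::]); char2.
Qed.

End Splits.

Arguments splits : simpl never.

Section BarDifferential.
Variables (A : algType 'F_2) (d : A -> A).
Implicit Types (s t u v : seq A) (a x y z : A).

Section Def.
Variable W : lmodType 'F_2.
Implicit Types (f : seq A -> W) (G : A -> seq A -> W) (H : seq A -> A -> W).

(** The value 0 on an empty word means that there is no neighbour to merge with. *)
Definition rmerge G x s : W := if s is y :: s' then G (x * y) s' else 0.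

Definition lmerge H s x : W :=
  if s is y :: s' then H (belast y s') (last y s' * x) else 0.

(* bard f is f precomposed with the differential of the bar construction. *)
Fixpoint bard f s : W :=
  if s is x :: s' then
    f (d x :: s') + rmerge (fun y r => f (y :: r)) x s'
    + bard (fun r => f (x :: r)) s'
  else 0.

(* hochd G is G precomposed with the Hochschild differential. It is locked, like
   blockd, split2d and split3d below, so that rewriting sums does not unfold it. *)
Definition hochd G a s : W :=
  locked (G (d a) s + bard (G a) s + rmerge G a s + lmerge (fun r y => G y r) s a).

Lemma hochdE G a s : hochd G a s =
  G (d a) s + bard (G a) s + rmerge G a s + lmerge (fun r y => G y r) s a.
Proof. by rewrite /hochd -lock. Qed.

Lemma lmerge_rcons H s z x : lmerge H (rcons s z) x = H s (z * x).
Proof. by case: s => //= y s; rewrite belast_rcons last_rcons. Qed.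

Lemma lmerge_cons H y s x : lmerge H (y :: s) x =
  if s is [::] then H [::] (y * x) else lmerge (fun r => H (y :: r)) s x.
Proof. by case: s. Qed.

Lemma eq_rmerge G G' : (forall x s, G x s = G' x s) -> rmerge G =2 rmerge G'.
Proof. by move=> e x [|y s] /=. Qed.

Lemma eq_lmerge H H' : (forall s x, H s x = H' s x) -> lmerge H =2 lmerge H'.
Proof. by move=> e [|y s] x /=. Qed.

(** No term of the bar differential is the empty word. This allows the comparison of a function with
    its lift to chains, which may differ on the empty bracket. *)
Lemma eq_bard_cons f f' : (forall x s, f (x :: s) = f' (x :: s)) -> bard f =1 bard f'.
Proof.
move=> e s; elim: s f f' e => //= x s IH f f' e; rewrite e; congr (_ + _ + _).
  exact: eq_rmerge.
by apply: IH => y r.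
Qed.

Lemma eq_bard f f' : f =1 f' -> bard f =1 bard f'.
Proof. by move=> e; apply: eq_bard_cons. Qed.

Lemma eq_hochd G G' : (forall x s, G x s = G' x s) -> hochd G =2 hochd G'.
Proof.
move=> e a s; rewrite !hochdE e (@eq_bard _ (G' a)) //; congr (_ + _ + _).
  exact: eq_rmerge.
by apply: eq_lmerge.
Qed.

Lemma bard_cat f s x t : bard f (s ++ x :: t) =
  bard (fun r => f (r ++ x :: t)) s + f (s ++ d x :: t)
  + bard (fun r => f (s ++ x :: r)) t
  + lmerge (fun r y => f (r ++ y :: t)) s x
  + rmerge (fun y r => f (s ++ y :: r)) x t.
Proof.
elim: s f => [|y s IH] f; first by rewrite /=; char2.
rewrite /= (IH (fun r => f (y :: r))).
by case: s {IH} => [|z s] /=; char2.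
Qed.

End Def.

Section Linear.
Variables (W : lmodType 'F_2) (I : Type) (L : seq I).

Lemma rmerge_sum (G : I -> A -> seq A -> W) x s :
  rmerge (fun y r => \sum_(i <- L) G i y r) x s = \sum_(i <- L) rmerge (G i) x s.
Proof. by case: s => //=; rewrite big1. Qed.

Lemma lmerge_sum (H : I -> seq A -> A -> W) s x :
  lmerge (fun r y => \sum_(i <- L) H i r y) s x = \sum_(i <- L) lmerge (H i) s x.
Proof. by case: s => //=; rewrite big1. Qed.

Lemma bard_sum (f : I -> seq A -> W) s :
  bard (fun r => \sum_(i <- L) f i r) s = \sum_(i <- L) bard (f i) s.
Proof.
elim: s f => [|x s IH] f /=; first by rewrite big1.
by rewrite (IH (fun i r => f i (x :: r))) rmerge_sum -!big_split.
Qed.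

Lemma hochd_sum (G : I -> A -> seq A -> W) a s :
  hochd (fun b r => \sum_(i <- L) G i b r) a s = \sum_(i <- L) hochd (G i) a s.
Proof.
under eq_bigr do rewrite hochdE.
rewrite hochdE bard_sum rmerge_sum (lmerge_sum (fun i r y => G i y r)).
by rewrite -!big_split.
Qed.

Lemma bardD (f g : seq A -> W) s :
  bard (fun r => f r + g r) s = bard f s + bard g s.
Proof.
elim: s f g => [|x s IH] f g /=; first by rewrite addr0.
rewrite (IH (fun r => f (x :: r))) (_ : rmerge _ _ _ =
  rmerge (fun y r => f (y :: r)) x s + rmerge (fun y r => g (y :: r)) x s).
  by char2.
by case: s {IH} => //=; rewrite addr0.
Qed.

Lemma bard_linear (V : lmodType 'F_2) (F : {linear W -> V}) (f : seq A -> W) s :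
  F (bard f s) = bard (F \o f) s.
Proof.
elim: s f => [|x s IH] f /=; first by rewrite linear0.
by rewrite !linearD IH; case: s {IH} => //=; rewrite linear0.
Qed.

Lemma hochd_linear (V : lmodType 'F_2) (F : {linear W -> V}) (G : A -> seq A -> W) a s :
  F (hochd G a s) = hochd (fun b r => F (G b r)) a s.
Proof.
rewrite !hochdE !linearD bard_linear; congr (_ + _ + _ + _).
  by case: s => //=; rewrite linear0.
by case: s => //=; rewrite linear0.
Qed.

End Linear.

Section SplitSums.
Variable W : lmodType 'F_2.
Implicit Types phi : seq A -> seq A -> W.

(** Deconcatenation is a chain map: a cut of a word with two merged letters is a cut of the original
    word that does not separate these letters, so the merge takes place inside one of the pieces. *)
Lemma bard_sum_splits phi t :
  bard (fun r => \sum_(p <- splits r) phi p.1 p.2) t =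
  \sum_(p <- splits t) (bard (phi^~ p.2) p.1 + bard (phi p.1) p.2).
Proof.
elim: t phi => [|y t IH] phi; first by rewrite big_seq1 /= addr0.
rewrite (sum_splits_cons (fun u v => bard (phi^~ v) u + bard (phi u) v)) /=.
have -> : bard (fun r => \sum_(p <- splits (y :: r)) phi p.1 p.2) t =
    bard (fun r => phi [::] (y :: r)) t
    + \sum_(p <- splits t) (bard (fun r => phi (y :: r) p.2) p.1
                            + bard (phi (y :: p.1)) p.2).
  rewrite -(IH (fun u => phi (y :: u))) -bardD.
  by apply: eq_bard => r; rewrite sum_splits_cons.
have -> : rmerge (fun z r => \sum_(p <- splits (z :: r)) phi p.1 p.2) y t =
    rmerge (fun z r => phi [::] (z :: r)) y t
    + \sum_(p <- splits t) rmerge (fun z r => phi (z :: r) p.2) y p.1.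
  case: t {IH} => [|z t] /=; first by rewrite big_seq1 addr0.
  rewrite sum_splits_cons.
  rewrite (sum_splits_cons (fun u v => rmerge (fun z r => phi (z :: r) v) y u)).
  by rewrite /= add0r.
rewrite sum_splits_cons !big_split /=.
by char2.
Qed.

Lemma rmerge_sum_splits (phi : A -> seq A -> seq A -> W) x t :
  rmerge (fun y r => \sum_(p <- splits r) phi y p.1 p.2) x t =
  \sum_(p <- splits t) rmerge (fun y r => phi y r p.2) x p.1.
Proof.
case: t => [|z t] /=; first by rewrite big_seq1.
by rewrite (sum_splits_cons (fun u v => rmerge (fun y r => phi y r v) x u)) /= add0r.
Qed.

Lemma lmerge_sum_splits (phi : seq A -> seq A -> A -> W) t x :
  lmerge (fun r y => \sum_(p <- splits r) phi p.1 p.2 y) t x =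
  \sum_(p <- splits t) lmerge (phi p.1) p.2 x.
Proof.
elim: t phi => [|z t IH] phi; first by rewrite big_seq1.
rewrite (sum_splits_cons (fun u v => lmerge (phi u) v x)) !lmerge_cons.
case: t IH => [|y t] IH; first by rewrite !big_seq1 /= addr0.
rewrite -(IH (fun u => phi (z :: u))) /=.
by rewrite (sum_splits_cons (fun u v => phi u v (last y t * x))).
Qed.

End SplitSums.
End BarDifferential.

(** * Multilinear functions and the Casimir element *)

Section LinearPred.
Variables (U V : lmodType 'F_2) (f : U -> V).
Hypothesis fl : linear f.

Definition linear_map : {linear U -> V} :=
  HB.pack f (GRing.isLinear.Build 'F_2 U V *:%R f fl).

Lemma lin0 : f 0 = 0. Proof. exact: (linear0 linear_map). Qed.

Lemma linD x y : f (x + y) = f x + f y. Proof. exact: (linearD linear_map). Qed.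

Lemma linZ c x : f (c *: x) = c *: f x. Proof. exact: (linearZ_LR linear_map). Qed.

Lemma lin_sum I (r : seq I) (P : pred I) (g : I -> U) :
  f (\sum_(i <- r | P i) g i) = \sum_(i <- r | P i) f (g i).
Proof. exact: (linear_sum linear_map). Qed.

End LinearPred.

Lemma linear_sum_fun (U V : lmodType 'F_2) I (r : seq I) (f : I -> U -> V) :
  (forall i, linear (f i)) -> linear (fun x => \sum_(i <- r) f i x).
Proof.
move=> fl c x y; rewrite scaler_sumr -big_split /=; apply: eq_bigr => i _.
exact: fl.
Qed.

Lemma linear_comp_fun (U V W : lmodType 'F_2) (f : V -> W) (g : U -> V) :
  linear f -> linear g -> linear (fun x => f (g x)).
Proof. by move=> fl gl c x y; rewrite gl fl. Qed.

Lemma linear_mull (A : algType 'F_2) (a : A) : linear (fun x => a * x).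
Proof. by move=> c x y; rewrite mulrDr scalerAr. Qed.

Lemma linear_mulr (A : algType 'F_2) (a : A) : linear (fun x => x * a).
Proof. by move=> c x y; rewrite mulrDl scalerAl. Qed.

Definition bilin (U V W : lmodType 'F_2) (f : U -> V -> W) :=
  (forall v, linear (f^~ v)) /\ (forall u, linear (f u)).

Section BilinearClosure.
Variables U V W : lmodType 'F_2.

Lemma bilinD (f g : U -> V -> W) :
  bilin f -> bilin g -> bilin (fun x y => f x y + g x y).
Proof.
move=> [fl fr] [gl gr]; split=> z c x y.
  by rewrite fl gl scalerDr addrACA.
by rewrite fr gr scalerDr addrACA.
Qed.

Lemma bilin_compl (T : lmodType 'F_2) (f : U -> V -> W) (g : T -> U) :
  bilin f -> linear g -> bilin (fun x y => f (g x) y).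
Proof.
move=> [fl fr] gl; split=> z; last exact: fr.
exact: linear_comp_fun (fl z) gl.
Qed.

Lemma bilin_compr (T : lmodType 'F_2) (f : U -> V -> W) (g : T -> V) :
  bilin f -> linear g -> bilin (fun x y => f x (g y)).
Proof.
move=> [fl fr] gl; split=> z; first exact: fl.
exact: linear_comp_fun (fr z) gl.
Qed.

Lemma bilin_comp (T : lmodType 'F_2) (f : U -> V -> W) (g : W -> T) :
  bilin f -> linear g -> bilin (fun x y => g (f x y)).
Proof.
move=> [fl fr] gl; split=> z; first exact: linear_comp_fun gl (fl z).
exact: linear_comp_fun gl (fr z).
Qed.

Lemma bilin_swap (f : U -> V -> W) : bilin f -> bilin (fun y x => f x y).
Proof. by case. Qed.

End BilinearClosure.

Section PresentedInd.
Variables (K : nzRingType) (X : choiceType) (rel : {freeg X / K} -> Prop).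

Lemma presented_ind (P : presented rel -> Prop) :
    P 0 -> (forall c x y, P x -> P y -> P (c *: x + y)) ->
    (forall x, P (pgen rel x)) ->
  forall x, P x.
Proof.
move=> P0 PD Pg x; rewrite -[x]to_modqK; move: (repr _) => D.
rewrite -[D]freeg_sumE raddf_sum /=.
elim: (dom D) => [|w ws IH]; first by rewrite big_nil.
rewrite big_cons; have -> : << coeff w D *g w >> = coeff w D *: << w >> :> {freeg X / K}.
  by apply/eqP/freeg_eqP => z; rewrite coeffZ !coeffU mul1r.
by rewrite linearZ_LR; apply: PD => //; exact: Pg.
Qed.

End PresentedInd.

Lemma rchains_ind (A : algType 'F_2) (P : rchains A -> Prop) :
    P 0 -> (forall c x y, P x -> P y -> P (c *: x + y)) ->
    (forall a s, s != [::] -> P (rgen a s)) ->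
  forall x, P x.
Proof.
move=> P0 PD Pg; apply: presented_ind => // -[a [|b s]]; last exact: Pg.
by rewrite -/(rgen a [::]) rgen_nil.
Qed.

Lemma rchains_ext (A : algType 'F_2) (W : lmodType 'F_2) (f g : rchains A -> W) :
    linear f -> linear g -> (forall a s, s != [::] -> f (rgen a s) = g (rgen a s)) ->
  f =1 g.
Proof.
move=> fl gl fg; apply: rchains_ind => //; first by rewrite !lin0.
by move=> c x y fgx fgy; rewrite fl gl fgx fgy.
Qed.

Section TensorBasics.
Variables U V : lmodType 'F_2.

Lemma tens_linearl v : linear (fun u : U => tens u v : tensor U V).
Proof.
move=> c a b; rewrite /tens /pgen -(linearP (to_modq _)); apply/to_modq_eqP.
exact/lspan_gen/tensor_rel_l.
Qed.

Lemma tens_linearr u : linear (fun v : V => tens u v : tensor U V).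
Proof.
move=> c a b; rewrite /tens /pgen -(linearP (to_modq _)); apply/to_modq_eqP.
exact/lspan_gen/tensor_rel_r.
Qed.

Lemma tensor_sum (x : tensor U V) :
  exists E : seq (U * V), x = \sum_(p <- E) tens p.1 p.2.
Proof.
elim/presented_ind: x => [|c x y [E1 ->] [E2 ->]|[u v]].
- by exists [::]; rewrite big_nil.
- exists ([seq (c *: p.1, p.2) | p <- E1] ++ E2).
  rewrite big_cat big_map scaler_sumr /=; congr (_ + _); apply: eq_bigr => p _.
  by rewrite (linZ (tens_linearl p.2)).
- by exists [:: (u, v)]; rewrite big_seq1.
Qed.

Lemma tlift_linear_bilin (W : lmodType 'F_2) (f : U -> V -> W) :
  bilin f -> linear (tlift f).
Proof. by case=> fl fr; apply: tlift_linear. Qed.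

Lemma tlift_sum (W : lmodType 'F_2) (f : U -> V -> W) (E : seq (U * V)) :
  bilin f -> tlift f (\sum_(p <- E) tens p.1 p.2) = \sum_(p <- E) f p.1 p.2.
Proof.
move=> fb; rewrite (lin_sum (tlift_linear_bilin fb)); apply: eq_bigr => p _.
by case: fb => fl fr; rewrite tlift_tens.
Qed.

End TensorBasics.

(* E lists the pairs of a decomposition of a symmetric, closed element of
   A (x) A on which the two A-module structures agree. *)
Definition casimir (A : comAlgType 'F_2) (D : dg_algebra A) (E : seq (A * A)) : Prop :=
  forall (W : lmodType 'F_2) (f : A -> A -> W), bilin f ->
  [/\ forall a, \sum_(p <- E) f (a * p.1) p.2 = \sum_(p <- E) f p.1 (a * p.2),
      \sum_(p <- E) f p.1 p.2 = \sum_(p <- E) f p.2 p.1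
    & \sum_(p <- E) f (diff D p.1) p.2 = \sum_(p <- E) f p.1 (diff D p.2)].

Section Casimir.
Variables (A : comAlgType 'F_2) (m : int) (F : open_frobenius A m).
Local Notation d := (diff F).

Definition coprod_by (E : seq (A * A)) : Prop :=
  forall (W : lmodType 'F_2) (f : A -> A -> W), bilin f ->
  forall a, coprod_sum F a f = \sum_(p <- E) f (a * p.1) p.2.

(** Everything is read off from the coproduct of 1. The left module rule determines the coproduct
    from it, comparison with the right rule gives the Casimir identity, and closedness is the chain
    map property at 1, since d 1 = 0. Identities in the tensor square are tested on all bilinear
    maps. *)
Lemma coprod_casimir : symmetric_frobenius F ->
  exists E, casimir F E /\ coprod_by E.
Proof.
move=> sym; have [E cE] := tensor_sum (coprod F 1); exists E.
have cop : coprod_by E.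
  move=> W f fb a; rewrite /coprod_sum -[a in coprod F a]mulr1 coprod_lmod cE.
  rewrite tlift_sum; last first.
    split=> v; first exact: linear_comp_fun (tens_linearl v) (linear_mull a).
    exact: tens_linearr.
  rewrite (lin_sum (tlift_linear_bilin fb)); apply: eq_bigr => p _.
  by case: fb => fl fr; rewrite tlift_tens.
split=> // W f fb; split=> [a||].
- rewrite -cop // /coprod_sum -[a in coprod F a]mul1r coprod_rmod cE.
  rewrite tlift_sum; last first.
    split=> v; first exact: tens_linearl.
    exact: linear_comp_fun (tens_linearr v) (linear_mulr a).
  rewrite (lin_sum (tlift_linear_bilin fb)); apply: eq_bigr => p _.
  by case: fb => fl fr; rewrite tlift_tens // mulrC.
- rewrite -(tlift_sum _ fb) -cE -sym cE /tensor_swap tlift_sum; last first.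
    by split=> v; [exact: tens_linearr|exact: tens_linearl].
  rewrite (lin_sum (tlift_linear_bilin fb)); apply: eq_bigr => p _.
  by case: fb => fl fr; rewrite tlift_tens.
- apply/eq_addr2; rewrite -big_split /=.
  have := coprod_diff F 1; rewrite diff_one linear0 /tensor_diff cE tlift_sum; last first.
    split=> v; apply: linear_fadd.
    - exact: linear_comp_fun (tens_linearl v) (linearP d).
    - exact: tens_linearl.
    - exact: tens_linearr.
    - exact: linear_comp_fun (tens_linearr v) (linearP d).
  move/(congr1 (tlift f)); rewrite (lin0 (tlift_linear_bilin fb)) => {2}->.
  rewrite (lin_sum (tlift_linear_bilin fb)); apply: eq_bigr => p _.
  rewrite (linD (tlift_linear_bilin fb)).
  by case: fb => fl fr; rewrite !tlift_tens.
Qed.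

End Casimir.

Section Slotwise.
Variable A : algType 'F_2.

Section Def.
Variable W : lmodType 'F_2.
Implicit Types (f : seq A -> W) (G : A -> seq A -> W).

Definition slotwise f :=
  (forall s t, linear (fun x => f (s ++ x :: t))) /\
  (forall s t, f (s ++ 1 :: t) = 0).

(** These are the conditions under which [rlift G] is well defined on normalized chains. The empty
    bracket is left unconstrained because [rlift] discards it. *)
Definition chainwise G := (forall s, linear (G^~ s)) /\ (forall a, slotwise (G a)).

Lemma slotwise_linear f s t : slotwise f -> linear (fun x => f (s ++ x :: t)).
Proof. by case. Qed.

Lemma slotwise_linear0 f t : slotwise f -> linear (fun x => f (x :: t)).
Proof. by case=> fl _; exact: (fl [::]). Qed.

Lemma slotwise_catl f u : slotwise f -> slotwise (fun r => f (u ++ r)).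
Proof.
case=> fl f1; split=> s t; last by rewrite catA f1.
by move=> c x y; rewrite !catA fl.
Qed.

Lemma slotwise_catr f v : slotwise f -> slotwise (fun r => f (r ++ v)).
Proof.
case=> fl f1; split=> s t; last by rewrite -catA f1.
by move=> c x y; rewrite -!catA fl.
Qed.

Lemma slotwise_cons f x : slotwise f -> slotwise (fun r => f (x :: r)).
Proof. exact: (@slotwise_catl f [:: x]). Qed.

Lemma slotwise_sum I (r : seq I) (f : I -> seq A -> W) :
  (forall i, slotwise (f i)) -> slotwise (fun s => \sum_(i <- r) f i s).
Proof.
move=> fs; split=> s t; first by apply: linear_sum_fun => i; case: (fs i).
by rewrite big1 // => i _; case: (fs i).
Qed.

Lemma chainwise_sum I (r : seq I) (G : I -> A -> seq A -> W) :
  (forall i, chainwise (G i)) -> chainwise (fun a s => \sum_(i <- r) G i a s).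
Proof.
move=> Gs; split=> [s|a]; first by apply: linear_sum_fun => i; case: (Gs i).
by apply: slotwise_sum => i; case: (Gs i).
Qed.

Lemma slotwise_splits (phi : seq A -> seq A -> W) :
    (forall v, slotwise (phi^~ v)) -> (forall u, slotwise (phi u)) ->
  slotwise (fun t => \sum_(p <- splits t) phi p.1 p.2).
Proof.
move=> pl pr; split=> s t.
  move=> c x y; rewrite !sum_splits_cat scalerDr addrACA.
  congr (_ + _); rewrite scaler_sumr -big_split; apply: eq_bigr => p _ /=.
    by case: (pr p.1) => ->.
  by case: (pl p.2) => ->.
rewrite sum_splits_cat !big1 ?addr0 // => p _; first by case: (pl p.2) => _ ->.
by case: (pr p.1) => _ ->.
Qed.

Lemma chainwise_splits (phi : A -> seq A -> seq A -> W) :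
    (forall u v, linear (fun a => phi a u v)) ->
    (forall a v, slotwise (fun u => phi a u v)) ->
    (forall a u, slotwise (fun v => phi a u v)) ->
  chainwise (fun a t => \sum_(p <- splits t) phi a p.1 p.2).
Proof.
move=> ph pl pr; split=> [s|a]; first by apply: linear_sum_fun => p.
exact: slotwise_splits.
Qed.

Lemma rlift_linear_chainwise G : chainwise G -> linear (rlift G).
Proof. by case=> Gh Gs; apply: rlift_linear => // a s t; case: (Gs a). Qed.

Lemma rlift_chainwise G a s : chainwise G -> s != [::] -> rlift G (rgen a s) = G a s.
Proof. by case=> Gh Gs; apply: rlift_rgen => // b u v; case: (Gs b). Qed.

End Def.

Lemma slotwise_rgen a : slotwise (@rgen A a).
Proof. by split; [exact: rgen_slot|exact: rgen_unit]. Qed.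

Lemma chainwise_rgen : chainwise (@rgen A).
Proof. by split; [exact: rgen_head|exact: slotwise_rgen]. Qed.

End Slotwise.

(** Links the indexed sums of the definition to the recursive form in which all computations are
    made. *)
Lemma hoch_wordE (A : algType 'F_2) (d : A -> A) a s :
  hoch_word d a s = hochd d (@rgen A) a s.
Proof.
rewrite /hoch_word hochdE; case: s => [|x s].
  by rewrite /= !rgen_nil !big_ord0 !addr0.
have -> : lmerge (fun r y => rgen y r) (x :: s) a =
    rgen (last 0 (x :: s) * a) (take (size (x :: s)).-1 (x :: s)).
  congr rgen => /=; elim: s x => //= y s IH x; by rewrite IH.
rewrite [behead _]/= [(x :: s)`_0]/= [rmerge _ _ _]/=.
suff -> : bard d (rgen a) (x :: s) =
    \sum_(i < size (x :: s)) rgen a (take i (x :: s) ++ d (x :: s)`_i :: drop i.+1 (x :: s))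
    + \sum_(i < (size (x :: s)).-1) rgen a
        (take i (x :: s) ++ (x :: s)`_i * (x :: s)`_i.+1 :: drop i.+2 (x :: s)).
  by char2.
(* The induction needs an arbitrary [f], since passing to the tail puts the first letter inside
   it. *)
move: (rgen a) => f; elim: s x f => [|y s IH] x f.
  by rewrite big_ord_recl !big_ord0 /= !addr0.
rewrite [LHS](_ : _ = f [:: d x, y & s] + f (x * y :: s)
  + bard d (fun r => f (x :: r)) (y :: s)) // IH /= [X in _ = X + _]big_ord_recl.
rewrite [X in _ = _ + X]big_ord_recl /= !drop0; char2.
Qed.

Section HochschildDifferential.
Variables (A : comAlgType 'F_2) (D : dg_algebra A).
Local Notation d := (diff D).

Lemma hochD_rgenE a s : s != [::] -> hochD D (rgen a s) = hochd d (@rgen A) a s.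
Proof. by move=> s0; rewrite hochD_rgen // hoch_wordE. Qed.

Lemma rlift_hochD (W : lmodType 'F_2) (G : A -> seq A -> W) a s :
  chainwise G -> s != [::] -> rlift G (hochD D (rgen a s)) = hochd d G a s.
Proof.
move=> Gc s0; rewrite hochD_rgenE //.
rewrite [LHS](hochd_linear d (linear_map (rlift_linear_chainwise Gc)) (@rgen A)).
rewrite /linear_map /=.
have E b x r : rlift G (rgen b (x :: r)) = G b (x :: r) by exact: rlift_chainwise.
rewrite !hochdE; case: s s0 => // x s _; rewrite E.
rewrite (@eq_bard_cons _ d _ _ (G a)) //.
case: s => [|y s] /=; last by rewrite !E.
(* One-letter bracket: the lift gives 0 on both empty brackets, whereas [hochd] evaluates [G] on
   them; the two values agree by commutativity and cancel. *)
rewrite !rgen_nil !(lin0 (rlift_linear_chainwise Gc)) (mulrC x) !addr0 -!addrA.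
by rewrite addrr2 addr0.
Qed.

End HochschildDifferential.

(** * Splicing blocks into words *)

(** When the piece next to a marked letter is empty, a merge reaches through it to that letter; this
    records the extra term. *)
Definition at_end (T : Type) (W : lmodType 'F_2) (u : seq T) (x : W) : W :=
  if u is [::] then x else 0.

Lemma at_end_rcons (T : Type) (W : lmodType 'F_2) (u : seq T) z (x : W) :
  at_end (rcons u z) x = 0.
Proof. by case: u. Qed.

Section Expansions.
Variables (A : comAlgType 'F_2) (D : dg_algebra A) (W : lmodType 'F_2).
Local Notation d := (diff D).
Local Notation bard := (bard d).
Local Notation hochd := (hochd d).

Lemma rmerge_cat (G : A -> seq A -> W) x u w v :
  rmerge G x (u ++ w :: v) =
  rmerge (fun y r => G y (r ++ w :: v)) x u + at_end u (G (x * w) v).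
Proof. by case: u => [|y u] /=; rewrite ?add0r ?addr0. Qed.

Lemma lmerge_cat (H : seq A -> A -> W) u w v x :
  lmerge H (u ++ w :: v) x =
  lmerge (fun r y => H (u ++ w :: r) y) v x + at_end v (H u (w * x)).
Proof.
case/lastP: v => [|v z]; first by rewrite cats1 lmerge_rcons /= add0r.
by rewrite -rcons_cons -rcons_cat !lmerge_rcons at_end_rcons addr0.
Qed.

(** The part of the differential internal to a block with ends [x] and [y]: merges of the ends with
    letters outside are left out, and the ends never merge with each other because [s] is nonempty
    wherever this is used. *)
Definition blockd (Phi : A -> seq A -> A -> W) x s y : W :=
  locked (Phi (d x) s y + Phi x s (d y) + bard (fun r => Phi x r y) s
  + rmerge (fun z r => Phi z r y) x s + lmerge (fun r z => Phi x r z) s y).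

Lemma bard_block (f : seq A -> W) u x s y v : s != [::] ->
  bard f (u ++ x :: s ++ y :: v) =
  blockd (fun a r b => f (u ++ a :: r ++ b :: v)) x s y
  + bard (fun r => f (r ++ x :: s ++ y :: v)) u
  + bard (fun r => f (u ++ x :: s ++ y :: r)) v
  + lmerge (fun r z => f (r ++ z :: s ++ y :: v)) u x
  + rmerge (fun z r => f (u ++ x :: s ++ z :: r)) y v.
Proof.
case: s => // z s _; rewrite bard_cat (bard_cat d (fun r => f (u ++ x :: r))).
rewrite /blockd -lock [rmerge _ x _]/= [rmerge _ x (z :: s)]/=; char2.
Qed.

Variable E : seq (A * A).
Hypothesis Ecas : casimir D E.

(* The central mechanism: inserting the two halves of the Casimir element
   around a word turns its bar differential into the Hochschild differential,
   the wrap-around term being absorbed by the Casimir identity. *)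
Lemma blockd_sum (Phi : A -> seq A -> A -> W) a s :
    (forall r, bilin (fun x y => Phi x r y)) ->
  \sum_(p <- E) blockd Phi (a * p.1) s p.2 =
  hochd (fun b r => \sum_(p <- E) Phi (b * p.1) r p.2) a s.
Proof.
move=> Phib; have Phia b r : bilin (fun x y => Phi (b * x) r y).
  split=> [y|x]; last exact: (proj2 (Phib r)).
  exact: linear_comp_fun (proj1 (Phib r) y) (linear_mull b).
under eq_bigr do rewrite /blockd -lock.
rewrite !hochdE bard_sum !big_split /=.
have -> : \sum_(p <- E) Phi (d (a * p.1)) s p.2 =
    \sum_(p <- E) Phi (d a * p.1) s p.2 + \sum_(p <- E) Phi (a * d p.1) s p.2.
  rewrite -big_split; apply: eq_bigr => p _ /=.
  by rewrite diff_mul (linD (proj1 (Phib s) p.2)).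
(* Closedness moves the differential to the second half, where it cancels the term with [d p.2]. *)
have [_ _ ->] := Ecas (Phia a s).
have -> : \sum_(p <- E) rmerge (fun z r => Phi z r p.2) (a * p.1) s =
    rmerge (fun b r => \sum_(p <- E) Phi (b * p.1) r p.2) a s.
  case: s => [|z s] /=; first by rewrite big1.
  by apply: eq_bigr => p _; rewrite mulrAC.
have -> : \sum_(p <- E) lmerge (fun r z => Phi (a * p.1) r z) s p.2 =
    lmerge (fun r y => \sum_(p <- E) Phi (y * p.1) r p.2) s a.
  case/lastP: s => [|s z] /=; first by rewrite big1.
  rewrite lmerge_rcons; under eq_bigr do rewrite lmerge_rcons.
  have [<- _ _] := Ecas (Phia a s).
  by apply: eq_bigr => p _; rewrite mulrA (mulrC z).
by char2.
Qed.

End Expansions.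

Section SplitDifferentials.
Variables (A : comAlgType 'F_2) (D : dg_algebra A) (W : lmodType 'F_2).
Local Notation d := (diff D).
Local Notation bard := (bard d).
Local Notation hochd := (hochd d).

(* The part of the Hochschild differential of a cyclic word cut into pieces
   that does not involve the cuts. *)
Definition split2d (phi : A -> seq A -> seq A -> W) b u v : W :=
  locked (phi (d b) u v + bard (phi b ^~ v) u + bard (phi b u) v
  + rmerge (fun y r => phi y r v) b u + lmerge (fun r y => phi y u r) v b).

Definition split3d (phi : A -> seq A -> seq A -> seq A -> W) b u v w : W :=
  locked (phi (d b) u v w + bard (fun r => phi b r v w) u
  + bard (fun r => phi b u r w) v + bard (phi b u v) w
  + rmerge (fun y r => phi y r v w) b u + lmerge (fun r y => phi y u v r) w b).

Lemma hochd_splits (phi : A -> seq A -> seq A -> W) b t :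
  \sum_(p <- splits t) split2d phi b p.1 p.2 =
  hochd (fun c r => \sum_(p <- splits r) phi c p.1 p.2) b t.
Proof.
under eq_bigr do rewrite /split2d -lock.
rewrite !hochdE bard_sum_splits rmerge_sum_splits.
rewrite (lmerge_sum_splits (fun u r y => phi y u r)) !big_split /=; char2.
Qed.

Lemma split2d_sum I (L : seq I) (phi : I -> A -> seq A -> seq A -> W) b u v :
  \sum_(i <- L) split2d (phi i) b u v =
  split2d (fun c r s => \sum_(i <- L) phi i c r s) b u v.
Proof.
under eq_bigr do rewrite /split2d -lock.
rewrite /split2d -lock !bard_sum rmerge_sum (lmerge_sum _ (fun i r y => phi i y u r)).
by rewrite !big_split.
Qed.

Lemma split3d_sum I (L : seq I) (phi : I -> A -> seq A -> seq A -> seq A -> W) b u v w :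
  \sum_(i <- L) split3d (phi i) b u v w =
  split3d (fun c r s t => \sum_(i <- L) phi i c r s t) b u v w.
Proof.
under eq_bigr do rewrite /split3d -lock.
rewrite /split3d -lock !bard_sum rmerge_sum (lmerge_sum _ (fun i r y => phi i y u v r)).
by rewrite !big_split.
Qed.

Lemma hochd_splits3 (phi : A -> seq A -> seq A -> seq A -> W) b t :
  \sum_(p <- splits t) \sum_(q <- splits p.1) split3d phi b q.1 q.2 p.2 =
  hochd (fun c r => \sum_(p <- splits r) \sum_(q <- splits p.1) phi c q.1 q.2 p.2) b t.
Proof.
rewrite -(hochd_splits (fun c u w => \sum_(q <- splits u) phi c q.1 q.2 w)).
apply: eq_bigr => p _; rewrite /split2d -lock (bard_sum_splits d (fun u v => phi b u v p.2)).
rewrite (bard_sum d _ (fun q => phi b q.1 q.2)).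
rewrite (rmerge_sum_splits (fun y u v => phi y u v p.2)).
rewrite (lmerge_sum _ (fun q r y => phi y q.1 q.2 r)) -!big_split /=.
by apply: eq_bigr => q _; rewrite /split3d -lock; char2.
Qed.

End SplitDifferentials.

(** * Lifting functions of two and three words to chains *)

Section MultilinearLifts.
Variables (A : algType 'F_2) (W : lmodType 'F_2).

Lemma eq_chainwise (G G' : A -> seq A -> W) :
  (forall a s, G a s = G' a s) -> chainwise G' -> chainwise G.
Proof. by move=> e; suff -> : G = G' by []; apply/funext => a; apply/funext. Qed.

Lemma chainwise0 : chainwise (fun (_ : A) (_ : seq A) => 0 : W).
Proof. by split=> [s|a]; [|split=> s t //]; move=> c x y; rewrite scaler0 addr0. Qed.

Lemma chainwise_comb c (G G' : A -> seq A -> W) :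
  chainwise G -> chainwise G' -> chainwise (fun a s => c *: G a s + G' a s).
Proof.
have lin (f g : A -> W) : linear f -> linear g -> linear (fun x => c *: f x + g x).
  by move=> fl gl; apply: linear_fadd => // k x y; rewrite fl scalerDr !scalerA mulrC.
move=> [Gh Gs] [Gh' Gs']; split=> [s|a]; first exact: lin.
split=> s t; first by apply: lin; [case: (Gs a)|case: (Gs' a)].
by case: (Gs a) (Gs' a) => _ -> [_ ->]; rewrite scaler0 addr0.
Qed.

Definition chainwise2 (X : A -> seq A -> A -> seq A -> W) :=
  (forall a s, chainwise (X a s)) /\ (forall b t, chainwise (fun a s => X a s b t)).

Definition rlift2 (X : A -> seq A -> A -> seq A -> W) (x y : rchains A) : W :=
  rlift (fun a s => rlift (X a s) y) x.

Definition chainwise3 (X : A -> seq A -> A -> seq A -> A -> seq A -> W) :=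
  (forall a s, chainwise2 (X a s)) /\
  (forall b t c u, chainwise (fun a s => X a s b t c u)).

Definition rlift3 (X : A -> seq A -> A -> seq A -> A -> seq A -> W) (x y z : rchains A) : W :=
  rlift (fun a s => rlift2 (X a s) y z) x.

Section Two.
Variable X : A -> seq A -> A -> seq A -> W.
Hypothesis Xc : chainwise2 X.

(** For a general [y] the inner lift is not an explicit formula on words, so the property is carried
    from generators to [y] through linear combinations. *)
Lemma chainwise_rlift y : chainwise (fun a s => rlift (X a s) y).
Proof.
case: Xc => Xr Xl; elim/rchains_ind: y => [|c x y xc yc|b t t0].
- apply: eq_chainwise chainwise0 => a s.
  by rewrite (lin0 (rlift_linear_chainwise (Xr a s))).
- apply: eq_chainwise (chainwise_comb c xc yc) => a s.
  exact: (rlift_linear_chainwise (Xr a s)).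
- by apply: eq_chainwise (Xl b t) => a s; rewrite rlift_chainwise.
Qed.

Lemma rlift2_linearl y : linear (rlift2 X ^~ y).
Proof. exact/rlift_linear_chainwise/chainwise_rlift. Qed.

Lemma rlift2_rgenl a s y : s != [::] -> rlift2 X (rgen a s) y = rlift (X a s) y.
Proof. by move=> s0; rewrite /rlift2 (rlift_chainwise _ (chainwise_rlift y)). Qed.

Lemma rlift2_linearr x : linear (rlift2 X x).
Proof.
elim/rchains_ind: x => [|c x y xl yl|a s s0] k u v.
- by rewrite !(lin0 (rlift2_linearl _)) scaler0 addr0.
- by rewrite !rlift2_linearl xl yl !scalerDr !scalerA mulrC addrACA.
- by rewrite !rlift2_rgenl // (rlift_linear_chainwise (proj1 Xc a s)).
Qed.

Lemma rlift2_rgen a s b t : s != [::] -> t != [::] ->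
  rlift2 X (rgen a s) (rgen b t) = X a s b t.
Proof. by move=> s0 t0; rewrite rlift2_rgenl // rlift_chainwise //; case: Xc. Qed.

Lemma rlift2_rgenr x b t : t != [::] ->
  rlift2 X x (rgen b t) = rlift (fun a s => X a s b t) x.
Proof.
move=> t0; have Xl := proj2 Xc b t; move: x; apply: rchains_ext.
- exact: rlift2_linearl.
- exact: rlift_linear_chainwise.
- by move=> a s s0; rewrite rlift2_rgen // rlift_chainwise.
Qed.

End Two.

Section Three.
Variable X : A -> seq A -> A -> seq A -> A -> seq A -> W.
Hypothesis Xc : chainwise3 X.

Lemma chainwise_rlift2 y z : chainwise (fun a s => rlift2 (X a s) y z).
Proof.
case: Xc => Xr Xl; elim/rchains_ind: y => [|c x y xc yc|b t t0].
- apply: eq_chainwise chainwise0 => a s; exact: (lin0 (rlift2_linearl (Xr a s) z)).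
- apply: eq_chainwise (chainwise_comb c xc yc) => a s.
  exact: (rlift2_linearl (Xr a s)).
elim/rchains_ind: z => [|c x y xc yc|c u u0].
- apply: eq_chainwise chainwise0 => a s; exact: (lin0 (rlift2_linearr (Xr a s) _)).
- apply: eq_chainwise (chainwise_comb c xc yc) => a s.
  exact: (rlift2_linearr (Xr a s)).
- by apply: eq_chainwise (Xl b t c u) => a s; rewrite rlift2_rgen.
Qed.

Lemma rlift3_linear1 y z : linear (fun x => rlift3 X x y z).
Proof. exact/rlift_linear_chainwise/chainwise_rlift2. Qed.

Lemma rlift3_rgen1 a s y z : s != [::] ->
  rlift3 X (rgen a s) y z = rlift2 (X a s) y z.
Proof. by move=> s0; rewrite /rlift3 (rlift_chainwise _ (chainwise_rlift2 y z)). Qed.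

Lemma rlift3_linear2 x z : linear (fun y => rlift3 X x y z).
Proof.
elim/rchains_ind: x => [|c x y xl yl|a s s0] k u v.
- by rewrite !(lin0 (rlift3_linear1 _ _)) scaler0 addr0.
- by rewrite !rlift3_linear1 xl yl !scalerDr !scalerA mulrC addrACA.
- by rewrite !rlift3_rgen1 // (rlift2_linearl (proj1 Xc a s)).
Qed.

Lemma rlift3_linear3 x y : linear (rlift3 X x y).
Proof.
elim/rchains_ind: x => [|c x x' xl yl|a s s0] k u v.
- by rewrite !(lin0 (rlift3_linear1 _ _)) scaler0 addr0.
- by rewrite !rlift3_linear1 xl yl !scalerDr !scalerA mulrC addrACA.
- by rewrite !rlift3_rgen1 // (rlift2_linearr (proj1 Xc a s)).
Qed.

Lemma rlift3_rgen a s b t c u : s != [::] -> t != [::] -> u != [::] ->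
  rlift3 X (rgen a s) (rgen b t) (rgen c u) = X a s b t c u.
Proof.
by move=> s0 t0 u0; rewrite rlift3_rgen1 // rlift2_rgen //; case: Xc.
Qed.

Lemma rlift3_rgen23 x b t c u : t != [::] -> u != [::] ->
  rlift3 X x (rgen b t) (rgen c u) = rlift (fun a s => X a s b t c u) x.
Proof.
move=> t0 u0; have Xl := proj2 Xc b t c u; move: x; apply: rchains_ext.
- exact: rlift3_linear1.
- exact: rlift_linear_chainwise.
- by move=> a s s0; rewrite rlift3_rgen // rlift_chainwise.
Qed.

End Three.

Lemma rchains_ext2 (f g : rchains A -> rchains A -> W) :
    bilin f -> bilin g ->
    (forall a s b t, s != [::] -> t != [::] ->
      f (rgen a s) (rgen b t) = g (rgen a s) (rgen b t)) ->
  forall x y, f x y = g x y.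
Proof.
move=> [fl fr] [gl gr] fg x y; move: x; apply: rchains_ext => // a s s0.
by move: y; apply: rchains_ext => // b t t0; exact: fg.
Qed.

Lemma rchains_ext3 (f g : rchains A -> rchains A -> rchains A -> W) :
    (forall y z, linear (fun x => f x y z)) -> (forall x, bilin (f x)) ->
    (forall y z, linear (fun x => g x y z)) -> (forall x, bilin (g x)) ->
    (forall a s b t c u, s != [::] -> t != [::] -> u != [::] ->
      f (rgen a s) (rgen b t) (rgen c u) = g (rgen a s) (rgen b t) (rgen c u)) ->
  forall x y z, f x y z = g x y z.
Proof.
move=> f1 f23 g1 g23 fg x y z; move: x; apply: rchains_ext => // a s s0.
by move: y z; apply: rchains_ext2 => // b t c u t0 u0; exact: fg.
Qed.

End MultilinearLifts.

Section BlockBilinear.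
Variables (A : algType 'F_2) (W : lmodType 'F_2).

Lemma bilin_block (f : seq A -> W) u r v : slotwise f ->
  bilin (fun x y => f (u ++ x :: r ++ y :: v)).
Proof.
move=> fs; split=> x; first exact: slotwise_linear.
by move=> c y z; have := slotwise_linear (u ++ x :: r) v fs c y z; rewrite -!catA.
Qed.

Lemma slotwise_after (f : seq A -> W) u x : slotwise f -> slotwise (fun r => f (u ++ x :: r)).
Proof.
by move=> fs; apply: (slotwise_cons (f := fun r => f (u ++ r))) (slotwise_catl _ fs).
Qed.

Lemma slotwise_inside (f : seq A -> W) u x y v :
  slotwise f -> slotwise (fun r => f (u ++ x :: r ++ y :: v)).
Proof.
by move=> fs; apply: (slotwise_catr (f := fun r => f (u ++ x :: r))) (slotwise_after _ _ fs).
Qed.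

Lemma slotwise_after2 (f : seq A -> W) u x s y :
  slotwise f -> slotwise (fun r => f (u ++ x :: s ++ y :: r)).
Proof.
by move=> fs; apply: (slotwise_after (f := fun r => f (u ++ x :: r))) (slotwise_after _ _ fs).
Qed.

Lemma bilin_mull (f : A -> A -> W) a : bilin f -> bilin (fun x y => f (a * x) y).
Proof.
move=> [fl fr]; split=> y; last exact: fr.
exact: linear_comp_fun (fl y) (linear_mull a).
Qed.

Lemma bilin_cat (G : A -> seq A -> W) r v :
  chainwise G -> bilin (fun x y => G x (r ++ y :: v)).
Proof.
move=> [Gh Gs]; split=> x; first exact: Gh.
exact: slotwise_linear.
Qed.

Lemma bilin_cat_flip (G : A -> seq A -> W) r v :
  chainwise G -> bilin (fun x y => G y (r ++ x :: v)).
Proof. by move=> Gc; apply: (bilin_swap (bilin_cat r v Gc)). Qed.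

Lemma bilin_sum I (L : seq I) (f : I -> A -> A -> W) :
  (forall i, bilin (f i)) -> bilin (fun x y => \sum_(i <- L) f i x y).
Proof. by move=> fb; split=> x; apply: linear_sum_fun => i; case: (fb i). Qed.

End BlockBilinear.

(** * The product on words and its Leibniz rule *)

Section Product.
Variables (A : comAlgType 'F_2) (D : dg_algebra A) (E : seq (A * A)).
Hypothesis Ecas : casimir D E.
Local Notation d := (diff D).
Local Notation bard := (bard d).
Local Notation hochd := (hochd d).
Local Notation rgen := (@rgen A).

Lemma nonempty_cat (s t : seq A) x : s ++ x :: t != [::].
Proof. by case: s. Qed.

Section CyclicBlock.
Variable W : lmodType 'F_2.
Implicit Type G : A -> seq A -> W.

(** The coefficient carries both [b] and the left half [x] of the block. Its merge with the first
    letter of [s] is attributed to [x], and its merge with the last letter of [t] to [b]. *)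
Lemma hochd_prod_block G b x s y t : chainwise G -> s != [::] -> t != [::] ->
  hochd G (b * x) (s ++ y :: t) =
  blockd D (fun z r w => G (b * z) (r ++ w :: t)) x s y
  + (G (d b * x) (s ++ y :: t) + bard (fun r => G (b * x) (s ++ y :: r)) t
    + lmerge (fun r z => G (z * x) (s ++ y :: r)) t b)
  + rmerge (fun z r => G (b * x) (s ++ z :: r)) y t.
Proof.
case=> Gh Gs; case: s => // z s _; case/lastP: t => // t w _.
rewrite !hochdE bard_cat lmerge_cat diff_mul (linD (Gh _)) at_end_rcons.
by rewrite /blockd -lock !lmerge_rcons /= !mulrA; char2.
Qed.

Lemma lmerge_block (H : seq A -> A -> W) u x s y v b :
  lmerge H (u ++ x :: s ++ y :: v) b =
  lmerge (fun r z => H (u ++ x :: s ++ y :: r) z) v b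
  + at_end v (H (u ++ x :: s) (y * b)).
Proof.
have -> : u ++ x :: s ++ y :: v = (u ++ x :: s) ++ y :: v by rewrite -catA.
rewrite lmerge_cat; congr (_ + _); apply: eq_lmerge => r z.
by rewrite -catA.
Qed.

(* The last two lines are the two cuts around the block. *)
Lemma hochd_cyclic_block G b u x s y v : s != [::] ->
  hochd G b (u ++ x :: s ++ y :: v) =
  blockd D (fun z r w => G b (u ++ z :: r ++ w :: v)) x s y
  + split2d D (fun c u v => G c (u ++ x :: s ++ y :: v)) b u v
  + (lmerge (fun r z => G b (r ++ z :: s ++ y :: v)) u x
     + at_end u (G (b * x) (s ++ y :: v))
     + (rmerge (fun z r => G b (u ++ x :: s ++ z :: r)) y v
        + at_end v (G (y * b) (u ++ x :: s)))).
Proof.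
by move=> s0; rewrite !hochdE /split2d -lock bard_block // rmerge_cat lmerge_block; char2.
Qed.

End CyclicBlock.

(** Supplies the hypothesis of [sum_splits_telescope] when a block moves past the letter [z]. *)
Lemma casimir_rotate (W : lmodType 'F_2) (f : A -> A -> W) a z : bilin f ->
  \sum_(p <- E) f (z * (a * p.1)) p.2 = \sum_(p <- E) f (a * p.1) (p.2 * z).
Proof.
move=> fb; have [/(_ z) + _ _] := Ecas (bilin_mull a fb).
under eq_bigr do rewrite mulrCA; move=> ->.
by apply: eq_bigr => p _; rewrite (mulrC z).
Qed.

(** Needed where the right half of a block has become the coefficient, or part of it: the product
    formula expects the left half there. *)
Lemma casimir_swap (W : lmodType 'F_2) (f : A -> A -> W) a : bilin f ->
  \sum_(p <- E) f (a * p.1) p.2 = \sum_(p <- E) f p.2 (a * p.1).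
Proof.
move=> fb; have [/(_ a)-> _ _] := Ecas fb.
have fb' : bilin (fun x y => f x (a * y)).
  split=> x; first exact: (proj1 fb).
  exact: linear_comp_fun (proj2 fb x) (linear_mull a).
by have [_ -> _] := Ecas fb'.
Qed.

Definition prod_word a s b t : rchains A :=
  \sum_(p <- E) rgen (a * b * p.1) (s ++ p.2 :: t).

Lemma prod_word_chainwise : chainwise2 prod_word.
Proof.
split=> [a s|b t]; apply: chainwise_sum => p; split=> u.
- exact: linear_comp_fun (rgen_head _)
    (linear_comp_fun (linear_mulr _) (linear_mull _)).
- exact: slotwise_after (slotwise_rgen _).
- exact: linear_comp_fun (rgen_head _)
    (linear_comp_fun (linear_mulr _) (linear_mulr _)).
- exact: slotwise_catr (slotwise_rgen _).
Qed.

Lemma prod_wordE a s b t :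
  prod_word a s b t = \sum_(p <- E) rgen (b * (a * p.1)) (s ++ p.2 :: t).
Proof. by apply: eq_bigr => p _; rewrite mulrCA mulrA. Qed.

Lemma hochD_prod_word a s b t : s != [::] -> t != [::] ->
  hochD D (prod_word a s b t) =
  hochd (fun c r => prod_word c r b t) a s + hochd (prod_word a s) b t.
Proof.
move=> s0 t0; rewrite prod_wordE linear_sum.
under eq_bigr => p _ do
  rewrite /= hochD_rgenE ?nonempty_cat // (hochd_prod_block _ _ _ (chainwise_rgen A)) //.
rewrite !big_split /= (blockd_sum Ecas); last first.
  by move=> r; apply: (bilin_mull b (bilin_cat r t (chainwise_rgen A))).
rewrite (eq_hochd d (G' := fun c r => prod_word c r b t)); last first.
  by move=> c r; rewrite prod_wordE.
rewrite -prod_wordE -bard_sum (eq_bard d (f' := prod_word a s b)); last first.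
  by move=> r; rewrite prod_wordE.
rewrite -(lmerge_sum _ (fun p r z => rgen (z * (a * p.1)) (s ++ p.2 :: r))).
rewrite (eq_lmerge (H' := fun r z => prod_word a s z r)); last first.
  by move=> r z; rewrite prod_wordE.
rewrite [X in _ = _ + X]hochdE.
(* The one term of the differential of the second word still missing, [b] absorbing the first letter
   of [t], appears here as a merge with [p.2] and is rotated through the block. *)
have -> : \sum_(p <- E) rmerge (fun z r => rgen (b * (a * p.1)) (s ++ z :: r)) p.2 t =
    rmerge (prod_word a s) b t.
  case: t t0 => //= z t _; rewrite prod_wordE.
  rewrite -(casimir_rotate (f := fun x y => rgen (b * x) (s ++ y :: t))).
    by apply: eq_bigr => p _; rewrite !mulrA.
  exact: (bilin_mull b (bilin_cat s t (chainwise_rgen A))).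
by char2.
Qed.

End Product.

(** * Insertion into a cyclic word and commutativity *)

Section Insertion.
Variables (A : comAlgType 'F_2) (D : dg_algebra A) (E : seq (A * A)).
Hypothesis Ecas : casimir D E.
Local Notation d := (diff D).
Local Notation hochd := (hochd d).
Local Notation rgen := (@rgen A).
Local Notation prod_word := (prod_word E).

(* Inserts the word x, between the two halves of the Casimir element, in all
   gaps of the cyclic word y; the failure of commutativity of the product is
   the boundary of this operation. *)
Definition insert_word a s b t : rchains A :=
  \sum_(p <- splits t) \sum_(q <- E) rgen b (p.1 ++ a * q.1 :: s ++ q.2 :: p.2).

Lemma insert_word_chainwise : chainwise2 insert_word.
Proof.
split=> [a s|b t].
  apply: (chainwise_splits (phi := fun b u v =>
    \sum_(q <- E) rgen b (u ++ a * q.1 :: s ++ q.2 :: v))) => [u v|b v|b u].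
  - by apply: linear_sum_fun => q; apply: rgen_head.
  - by apply: slotwise_sum => q; apply: slotwise_catr; apply: slotwise_rgen.
  - by apply: slotwise_sum => q; apply: slotwise_after2; apply: slotwise_rgen.
apply: chainwise_sum => p; apply: chainwise_sum => q; split=> u.
  exact: linear_comp_fun (slotwise_linear _ _ (slotwise_rgen _)) (linear_mulr _).
exact: slotwise_inside (slotwise_rgen _).
Qed.

Lemma hochD_insert_word a s b t : s != [::] -> t != [::] ->
  hochD D (insert_word a s b t) =
  hochd (fun c r => insert_word c r b t) a s + hochd (insert_word a s) b t
  + (prod_word a s b t + prod_word b t a s).
Proof.
move=> s0 t0; rewrite linear_sum /=.
(* [l] and [r] are the merges at the left and right ends of the block; at the first and last gaps
   the neighbour is the coefficient [b]. *)
pose l u v := \sum_(q <- E)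
  (lmerge (fun r z => rgen b (r ++ z :: s ++ q.2 :: v)) u (a * q.1)
   + at_end u (rgen (b * (a * q.1)) (s ++ q.2 :: v))).
pose r u v := \sum_(q <- E)
  (rmerge (fun z r => rgen b (u ++ a * q.1 :: s ++ z :: r)) q.2 v
   + at_end v (rgen (q.2 * b) (u ++ a * q.1 :: s))).
have step p : p \in splits t ->
    hochD D (\sum_(q <- E) rgen b (p.1 ++ a * q.1 :: s ++ q.2 :: p.2)) =
    hochd (fun c r => \sum_(q <- E) rgen b (p.1 ++ c * q.1 :: r ++ q.2 :: p.2)) a s
    + split2d D (fun c u v => \sum_(q <- E) rgen c (u ++ a * q.1 :: s ++ q.2 :: v)) b p.1 p.2
    + (l p.1 p.2 + r p.1 p.2).
  move=> _; rewrite linear_sum.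
  under eq_bigr do rewrite /= hochD_rgenE ?nonempty_cat // hochd_cyclic_block //.
  rewrite !big_split /= (blockd_sum Ecas) => [|w].
    by rewrite split2d_sum -!big_split.
  exact: bilin_block (slotwise_rgen b).
rewrite (eq_big_seq _ step) !big_split /=.
rewrite -(hochd_sum d _ (fun p c r =>
  \sum_(q <- E) rgen b (p.1 ++ c * q.1 :: r ++ q.2 :: p.2))).
rewrite hochd_splits -big_split sum_splits_telescope => [|u z v]; last first.
  rewrite /l /r; under eq_bigr do rewrite lmerge_rcons at_end_rcons addr0.
  under [RHS]eq_bigr do rewrite addr0 /=.
  apply: (casimir_rotate Ecas (f := fun x y => rgen b (u ++ x :: s ++ y :: v))).
  exact: bilin_block (slotwise_rgen b).
(* In the first gap the block follows [b], which gives the product of the inserted word with the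
   other one; in the last gap it precedes [b] cyclically, which gives the opposite product. *)
rewrite /l /r /=; congr (_ + (_ + _)).
  by rewrite prod_wordE; apply: eq_bigr => q _; rewrite add0r.
under eq_bigr do rewrite add0r.
rewrite (casimir_swap Ecas (f := fun x y => rgen (y * b) (t ++ x :: s))).
  by apply: eq_bigr => q _; rewrite mulrAC (mulrC a).
apply: (bilin_cat_flip (G := fun y r => rgen (y * b) r)); split=> u.
  exact: linear_comp_fun (rgen_head _) (linear_mulr b).
exact: slotwise_rgen.
Qed.

End Insertion.

(** * The Connes operator and rotated insertions *)

Section RotatedInsertion.
Variables (A : comAlgType 'F_2) (D : dg_algebra A) (E : seq (A * A)).
Hypothesis Ecas : casimir D E.
Local Notation d := (diff D).
Local Notation hochd := (hochd d).
Local Notation rgen := (@rgen A).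
Local Notation prod_word := (prod_word E).

Local Notation insert_word := (insert_word E).

Lemma sum_take_drop (W : lmodType 'F_2) (phi : seq A -> seq A -> W) t :
  \sum_(i < (size t).+1) phi (take i t) (drop i t) = \sum_(p <- splits t) phi p.1 p.2.
Proof.
elim: t phi => [|y t IH] phi; first by rewrite big_ord_recl big_ord0 sum_splits0 addr0.
by rewrite big_ord_recl sum_splits_cons -(IH (fun u => phi (y :: u))).
Qed.

Lemma connes_wordE b t :
  connes_word b t = \sum_(p <- splits t) rgen 1 (p.2 ++ b :: p.1).
Proof. exact: sum_take_drop (fun u v => rgen 1 (v ++ b :: u)) t. Qed.

Lemma connes_word_chainwise : chainwise (@connes_word A).
Proof.
split; first exact: connes_head.
by move=> a; split; [exact: connes_slot|exact: connes_unit].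
Qed.

(** Merges with the leading unit on its two sides telescope over the rotations. Both extreme terms
    are the word [b[t]] itself, so they cancel. *)
Lemma hochD_connes_word b t : t != [::] ->
  hochD D (connes_word b t) = hochd (@connes_word A) b t.
Proof.
move=> t0; rewrite connes_wordE linear_sum /=.
pose l (u v : seq A) := lmerge (fun r y => rgen y (v ++ b :: r)) u 1 + at_end u (rgen b v).
pose r (u v : seq A) := rmerge (fun y r => rgen y (r ++ b :: u)) 1 v + at_end v (rgen b u).
under eq_bigr => p _.
  rewrite hochD_rgenE ?nonempty_cat // (_ : hochd _ _ _ =
    split2d D (fun c u v => rgen 1 (v ++ c :: u)) b p.1 p.2
    + (l p.1 p.2 + r p.1 p.2)); first over.
  rewrite hochdE bard_cat rmerge_cat lmerge_cat diff_one (lin0 (rgen_head _)).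
  by rewrite /split2d -lock /l /r mul1r mulr1; char2.
rewrite big_split hochd_splits sum_splits_telescope => [|u z v]; last first.
  by rewrite /l /r lmerge_rcons at_end_rcons /= !addr0 mul1r mulr1.
rewrite /l /r /= !add0r addrr2 addr0.
by apply: eq_hochd => c s; rewrite connes_wordE.
Qed.

Lemma hochd_rotated_block (G : A -> seq A -> rchains A) b u x s y v w :
  chainwise G -> s != [::] ->
  hochd G 1 (w ++ b :: u ++ x :: s ++ y :: v) =
  blockd D (fun z r y' => G 1 (w ++ b :: u ++ z :: r ++ y' :: v)) x s y
  + split3d D (fun c u v w => G 1 (w ++ c :: u ++ x :: s ++ y :: v)) b u v w
  + (lmerge (fun r z => G 1 (w ++ b :: r ++ z :: s ++ y :: v)) u x
     + at_end u (G 1 (w ++ b * x :: s ++ y :: v))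
     + rmerge (fun z r => G 1 (w ++ b :: u ++ x :: s ++ z :: r)) y v)
  + (lmerge (fun r z => G z (w ++ b :: u ++ x :: s ++ y :: r)) v 1
     + at_end v (G y (w ++ b :: u ++ x :: s))
     + (rmerge (fun z r => G z (r ++ b :: u ++ x :: s ++ y :: v)) 1 w
        + at_end w (G b (u ++ x :: s ++ y :: v)))).
Proof.
move=> [Gh _] s0; rewrite hochdE diff_one (lin0 (Gh _)) bard_cat.
rewrite (bard_block _ (fun r => G 1 (w ++ b :: r))) // !rmerge_cat mul1r.
have -> : lmerge (fun r z => G z r) (w ++ b :: u ++ x :: s ++ y :: v) 1 =
    lmerge (fun r z => G z (w ++ b :: u ++ x :: s ++ y :: r)) v 1
    + at_end v (G y (w ++ b :: u ++ x :: s)).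
  have -> : w ++ b :: u ++ x :: s ++ y :: v = (w ++ b :: u) ++ x :: s ++ y :: v.
    by rewrite -catA.
  rewrite lmerge_block mulr1.
  congr (_ + _); last by rewrite -catA.
  by apply: eq_lmerge => r z; rewrite -catA.
by rewrite /split3d -lock; char2.
Qed.

(* The words of insert_word, rotated so as to start at any letter after the
   inserted block and put behind a unit. *)
Definition rotated_insert_word a s b t : rchains A :=
  \sum_(p <- splits t) \sum_(q <- splits p.1) \sum_(e <- E)
    rgen 1 (p.2 ++ b :: q.1 ++ a * e.1 :: s ++ e.2 :: q.2).

Lemma rotated_insert_word_chainwise : chainwise2 rotated_insert_word.
Proof.
have sl := @slotwise_rgen A; split=> [a s|b t].
  apply: (chainwise_splits (phi := fun b u w => \sum_(q <- splits u) \sum_(e <- E)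
    rgen 1 (w ++ b :: q.1 ++ a * e.1 :: s ++ e.2 :: q.2))) => [u w|b w|b u].
  - apply: linear_sum_fun => q; apply: linear_sum_fun => e.
    exact: slotwise_linear.
  - apply: (slotwise_splits (phi := fun u v => \sum_(e <- E)
      rgen 1 (w ++ b :: u ++ a * e.1 :: s ++ e.2 :: v))) => v.
    + apply: slotwise_sum => e; exact: slotwise_inside.
    + apply: slotwise_sum => e.
      apply: (slotwise_after2 (f := fun r => rgen 1 (w ++ b :: r))).
      exact: slotwise_after.
  - apply: slotwise_sum => q; apply: slotwise_sum => e; exact: slotwise_catr.
apply: chainwise_sum => p; apply: chainwise_sum => q; apply: chainwise_sum => e; split=> u.
  apply: (linear_comp_fun (f := fun x => rgen 1 (p.2 ++ b :: q.1 ++ x :: u ++ e.2 :: q.2))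
    _ (linear_mulr _)).
  apply: (slotwise_linear (f := fun r => rgen 1 (p.2 ++ b :: r))).
  exact: slotwise_after.
apply: (slotwise_inside (f := fun r => rgen 1 (p.2 ++ b :: r))).
exact: slotwise_after.
Qed.

(** The word [t] is cut into u, v, w, and two telescopes run. With w fixed, the merges at the ends
    of the block leave only the term with u empty, where the block absorbs [b]: this is half of B(x
    y). With u fixed, the merges with the leading unit leave v empty, where the right half of the
    block becomes the coefficient and gives B(y) x, and w empty, which is the unrotated
    insertion. *)
Lemma hochD_rotated_insert_word a s b t : s != [::] -> t != [::] ->
  hochD D (rotated_insert_word a s b t) =
  hochd (fun c r => rotated_insert_word c r b t) a s
  + hochd (rotated_insert_word a s) b t
  + (insert_word a s b t
     + \sum_(p <- splits t) prod_word 1 (p.2 ++ b :: p.1) a s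
     + \sum_(p <- splits t) \sum_(e <- E) rgen 1 (p.2 ++ b * (a * e.1) :: s ++ e.2 :: p.1)).
Proof.
move=> s0 t0; rewrite linear_sum /=.
pose l1 u v w := \sum_(e <- E)
  (lmerge (fun r z => rgen 1 (w ++ b :: r ++ z :: s ++ e.2 :: v)) u (a * e.1)
   + at_end u (rgen 1 (w ++ b * (a * e.1) :: s ++ e.2 :: v))).
pose r1 u v w := \sum_(e <- E)
  rmerge (fun z r => rgen 1 (w ++ b :: u ++ a * e.1 :: s ++ z :: r)) e.2 v.
pose l2 u v w := \sum_(e <- E)
  (lmerge (fun r z => rgen z (w ++ b :: u ++ a * e.1 :: s ++ e.2 :: r)) v 1
   + at_end v (rgen e.2 (w ++ b :: u ++ a * e.1 :: s))).
pose r2 u v w := \sum_(e <- E)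
  (rmerge (fun z r => rgen z (r ++ b :: u ++ a * e.1 :: s ++ e.2 :: v)) 1 w
   + at_end w (rgen b (u ++ a * e.1 :: s ++ e.2 :: v))).
have step u v w :
    hochD D (\sum_(e <- E) rgen 1 (w ++ b :: u ++ a * e.1 :: s ++ e.2 :: v)) =
    hochd (fun c r => \sum_(e <- E) rgen 1 (w ++ b :: u ++ c * e.1 :: r ++ e.2 :: v)) a s
    + split3d D (fun c u v w => \sum_(e <- E)
        rgen 1 (w ++ c :: u ++ a * e.1 :: s ++ e.2 :: v)) b u v w
    + (l1 u v w + r1 u v w) + (l2 u v w + r2 u v w).
  rewrite linear_sum.
  under eq_bigr do rewrite /= hochD_rgenE ?nonempty_cat //
    (hochd_rotated_block _ _ _ _ _ _ (chainwise_rgen A)) //.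
  rewrite !big_split /= (blockd_sum Ecas) => [|r].
    by rewrite split3d_sum -!big_split.
  apply: (bilin_block (f := fun r => rgen 1 (w ++ b :: r))).
  exact: slotwise_after (slotwise_rgen 1).
transitivity (\sum_(p <- splits t) \sum_(q <- splits p.1)
  (hochd (fun c r => \sum_(e <- E) rgen 1 (p.2 ++ b :: q.1 ++ c * e.1 :: r ++ e.2 :: q.2)) a s
    + split3d D (fun c u v w => \sum_(e <- E)
        rgen 1 (w ++ c :: u ++ a * e.1 :: s ++ e.2 :: v)) b q.1 q.2 p.2
    + (l1 q.1 q.2 p.2 + r1 q.1 q.2 p.2) + (l2 q.1 q.2 p.2 + r2 q.1 q.2 p.2))).
  apply: eq_bigr => p _; rewrite linear_sum; apply: eq_bigr => q _; exact: step.
under [LHS]eq_bigr do rewrite !big_split /=.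
rewrite !big_split /=.
have -> : \sum_(p <- splits t) \sum_(q <- splits p.1)
    hochd (fun c r => \sum_(e <- E)
      rgen 1 (p.2 ++ b :: q.1 ++ c * e.1 :: r ++ e.2 :: q.2)) a s =
    hochd (fun c r => rotated_insert_word c r b t) a s.
  by rewrite hochd_sum; apply: eq_bigr => p _; rewrite hochd_sum.
rewrite hochd_splits3.
have -> : \sum_(p <- splits t) \sum_(q <- splits p.1) l1 q.1 q.2 p.2
    + \sum_(p <- splits t) \sum_(q <- splits p.1) r1 q.1 q.2 p.2 =
    \sum_(p <- splits t) \sum_(e <- E) rgen 1 (p.2 ++ b * (a * e.1) :: s ++ e.2 :: p.1).
  rewrite -big_split; apply: eq_bigr => p _ /=; rewrite -big_split /=.
  rewrite (sum_splits_telescope (l := fun u v => l1 u v p.2)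
    (r := fun u v => r1 u v p.2)) => [|u z v].
    rewrite /l1 /r1 /= [X in _ + X]big1 // addr0.
    by apply: eq_bigr => e _; rewrite add0r.
  rewrite /l1 /r1; under eq_bigr do rewrite lmerge_rcons at_end_rcons addr0.
  apply: (casimir_rotate Ecas (f := fun x y => rgen 1 (p.2 ++ b :: u ++ x :: s ++ y :: v))).
  apply: (bilin_block (f := fun r => rgen 1 (p.2 ++ b :: r))).
  exact: slotwise_after (slotwise_rgen 1).
have -> : \sum_(p <- splits t) \sum_(q <- splits p.1) l2 q.1 q.2 p.2
    + \sum_(p <- splits t) \sum_(q <- splits p.1) r2 q.1 q.2 p.2 =
    \sum_(p <- splits t) prod_word 1 (p.2 ++ b :: p.1) a s + insert_word a s b t.
  (* Reassociation fixes the first piece and lets the cut between the other two move. *)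
  rewrite !sum_splits_assoc -!big_split; apply: eq_bigr => p _ /=; rewrite -big_split /=.
  rewrite sum_splits_telescope => [|v z w].
    rewrite /l2 /r2 /=; congr (_ + _); last by apply: eq_bigr => e _; rewrite add0r.
    under eq_bigr do rewrite add0r.
    rewrite (casimir_swap Ecas (f := fun x y => rgen y (p.2 ++ b :: p.1 ++ x :: s))).
      by apply: eq_bigr => e _; rewrite mul1r -catA.
    have := bilin_cat_flip (p.2 ++ b :: p.1) s (chainwise_rgen A).
    by under eq_fun do under eq_fun do rewrite -catA.
  rewrite /l2 /r2; apply: eq_bigr => e _.
  by rewrite lmerge_rcons at_end_rcons /= !addr0 mul1r mulr1.
by char2.
Qed.

End RotatedInsertion.

(** * Inserting two blocks at once *)

Section DoubleInsertion.
Variables (A : comAlgType 'F_2) (D : dg_algebra A) (E : seq (A * A)).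
Hypothesis Ecas : casimir D E.
Local Notation d := (diff D).
Local Notation hochd := (hochd d).
Local Notation rgen := (@rgen A).
Local Notation prod_word := (prod_word E).

Local Notation insert_word := (insert_word E).

Lemma hochd_two_blocks (W : lmodType 'F_2) (G : A -> seq A -> W) c u x s y v z t y' w :
  s != [::] -> t != [::] ->
  hochd G c (u ++ x :: s ++ y :: v ++ z :: t ++ y' :: w) =
  blockd D (fun x r y => G c (u ++ x :: r ++ y :: v ++ z :: t ++ y' :: w)) x s y
  + blockd D (fun z r y' => G c (u ++ x :: s ++ y :: v ++ z :: r ++ y' :: w)) z t y'
  + split3d D (fun c u v w => G c (u ++ x :: s ++ y :: v ++ z :: t ++ y' :: w)) c u v w
  + (lmerge (fun r x => G c (r ++ x :: s ++ y :: v ++ z :: t ++ y' :: w)) u x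
     + at_end u (G (c * x) (s ++ y :: v ++ z :: t ++ y' :: w))
     + (rmerge (fun y r => G c (u ++ x :: s ++ y :: r ++ z :: t ++ y' :: w)) y v
        + at_end v (G c (u ++ x :: s ++ y * z :: t ++ y' :: w))))
  + (lmerge (fun r z => G c (u ++ x :: s ++ y :: r ++ z :: t ++ y' :: w)) v z
     + (rmerge (fun y' r => G c (u ++ x :: s ++ y :: v ++ z :: t ++ y' :: r)) y' w
        + at_end w (G (y' * c) (u ++ x :: s ++ y :: v ++ z :: t)))).
Proof.
move=> s0 t0; rewrite hochd_cyclic_block // /split2d -lock.
rewrite (bard_block _ (fun r => G c (u ++ x :: s ++ y :: r))) // rmerge_cat.
rewrite (lmerge_block (fun r z => G z (u ++ x :: s ++ y :: r))).
have -> : at_end (v ++ z :: t ++ y' :: w) (G (y * c) (u ++ x :: s)) = 0.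
  by case: (v).
by rewrite /split3d -lock; char2.
Qed.

(** The block of the first word always precedes that of the second, so that adjacent blocks fuse
    into the product in this order. *)
Definition insert2_word a s b t c r : rchains A :=
  \sum_(p <- splits r) \sum_(q <- splits p.1) \sum_(e <- E) \sum_(e' <- E)
    rgen c (q.1 ++ a * e.1 :: s ++ e.2 :: q.2 ++ b * e'.1 :: t ++ e'.2 :: p.2).

Lemma insert2_word_chainwise : chainwise3 insert2_word.
Proof.
have sl := @slotwise_rgen A.
split=> [a s|b t c r]; last first.
  do 2!(apply: chainwise_sum => ?); apply: chainwise_sum => e; apply: chainwise_sum => e'.
  split=> u; last exact: slotwise_inside.
  exact: linear_comp_fun (slotwise_linear _ _ (sl _)) (linear_mulr _).
split=> [b t|c r]; last first.
  apply: chainwise_sum => p; apply: chainwise_sum => q.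
  apply: chainwise_sum => e; apply: chainwise_sum => e'.
  pose f r := rgen c (q.1 ++ a * e.1 :: s ++ e.2 :: r).
  have fs : slotwise f by exact: slotwise_after2.
  split=> u; last exact: (slotwise_inside (f := f)).
  exact: linear_comp_fun (slotwise_linear q.2 _ fs) (linear_mulr _).
apply: (chainwise_splits (phi := fun c u w => \sum_(q <- splits u)
  \sum_(e <- E) \sum_(e' <- E)
  rgen c (q.1 ++ a * e.1 :: s ++ e.2 :: q.2 ++ b * e'.1 :: t ++ e'.2 :: w)))
  => [u w|c w|c u].
- by do 3!(apply: linear_sum_fun => ?); apply: rgen_head.
- apply: (slotwise_splits (phi := fun u v => \sum_(e <- E) \sum_(e' <- E)
    rgen c (u ++ a * e.1 :: s ++ e.2 :: v ++ b * e'.1 :: t ++ e'.2 :: w))) => v;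
    apply: slotwise_sum => e; apply: slotwise_sum => e'; first exact: slotwise_catr.
  apply: (slotwise_catr (f := fun r => rgen c (v ++ a * e.1 :: s ++ e.2 :: r))).
  exact: slotwise_after2.
- apply: slotwise_sum => q; apply: slotwise_sum => e; apply: slotwise_sum => e'.
  apply: (slotwise_after2 (f := fun r => rgen c (q.1 ++ a * e.1 :: s ++ e.2 :: r))).
  exact: slotwise_after2.
Qed.

(** Each block telescopes over its gaps with the other fixed. The first block leaves its position
    next to [c], a product on the left, and its collision with the second block, an insertion of the
    product. The second block leaves its position at the end of the cyclic word, a product on the
    right. The collision is a single merge and is booked once, in [r1]. *)
Lemma hochD_insert2_word a s b t c r : s != [::] -> t != [::] -> r != [::] ->
  hochD D (insert2_word a s b t c r) =
  hochd (fun a s => insert2_word a s b t c r) a s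
  + hochd (fun b t => insert2_word a s b t c r) b t
  + hochd (insert2_word a s b t) c r
  + (\sum_(e <- E) insert_word (a * b * e.1) (s ++ e.2 :: t) c r
     + \sum_(p <- splits r) \sum_(e' <- E)
         prod_word a s c (p.1 ++ b * e'.1 :: t ++ e'.2 :: p.2)
     + \sum_(p <- splits r) \sum_(e <- E)
         prod_word c (p.1 ++ a * e.1 :: s ++ e.2 :: p.2) b t).
Proof.
move=> s0 t0 r0; rewrite linear_sum /=.
pose wd a s b t c u v w := \sum_(e <- E) \sum_(e' <- E)
  rgen c (u ++ a * e.1 :: s ++ e.2 :: v ++ b * e'.1 :: t ++ e'.2 :: w).
pose l1 u v w := \sum_(e <- E) \sum_(e' <- E)
  (lmerge (fun r x => rgen c (r ++ x :: s ++ e.2 :: v ++ b * e'.1 :: t ++ e'.2 :: w))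
     u (a * e.1)
   + at_end u (rgen (c * (a * e.1)) (s ++ e.2 :: v ++ b * e'.1 :: t ++ e'.2 :: w))).
pose r1 u v w := \sum_(e <- E) \sum_(e' <- E)
  (rmerge (fun y r => rgen c (u ++ a * e.1 :: s ++ y :: r ++ b * e'.1 :: t ++ e'.2 :: w))
     e.2 v
   + at_end v (rgen c (u ++ a * e.1 :: s ++ e.2 * (b * e'.1) :: t ++ e'.2 :: w))).
pose l2 u v w := \sum_(e <- E) \sum_(e' <- E)
  lmerge (fun r z => rgen c (u ++ a * e.1 :: s ++ e.2 :: r ++ z :: t ++ e'.2 :: w))
    v (b * e'.1).
pose r2 u v w := \sum_(e <- E) \sum_(e' <- E)
  (rmerge (fun y r => rgen c (u ++ a * e.1 :: s ++ e.2 :: v ++ b * e'.1 :: t ++ y :: r))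
     e'.2 w
   + at_end w (rgen (e'.2 * c) (u ++ a * e.1 :: s ++ e.2 :: v ++ b * e'.1 :: t))).
have step u v w : hochD D (wd a s b t c u v w) =
    hochd (fun a s => wd a s b t c u v w) a s + hochd (fun b t => wd a s b t c u v w) b t
    + split3d D (wd a s b t) c u v w
    + (l1 u v w + r1 u v w) + (l2 u v w + r2 u v w).
  have -> : hochd (fun a s => wd a s b t c u v w) a s =
      \sum_(e <- E) \sum_(e' <- E) blockd D (fun x r y =>
        rgen c (u ++ x :: r ++ y :: v ++ b * e'.1 :: t ++ e'.2 :: w)) (a * e.1) s e.2.
    rewrite exchange_big.
    under [RHS]eq_bigr => e' _.
      rewrite (blockd_sum Ecas); first over.
      by move=> r'; apply: bilin_block (slotwise_rgen c).
    rewrite -hochd_sum; apply: eq_hochd => x r'; exact: exchange_big.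
  have -> : hochd (fun b t => wd a s b t c u v w) b t =
      \sum_(e <- E) \sum_(e' <- E) blockd D (fun z r y' =>
        rgen c (u ++ a * e.1 :: s ++ e.2 :: v ++ z :: r ++ y' :: w)) (b * e'.1) t e'.2.
    under [RHS]eq_bigr => e _.
      rewrite (blockd_sum Ecas); first over.
      move=> r'; apply: (bilin_block (f := fun r => rgen c (u ++ a * e.1 :: s ++ e.2 :: r))).
      exact: slotwise_after2 (slotwise_rgen c).
    by rewrite -hochd_sum.
  have -> : split3d D (wd a s b t) c u v w =
      \sum_(e <- E) \sum_(e' <- E) split3d D (fun c u v w =>
        rgen c (u ++ a * e.1 :: s ++ e.2 :: v ++ b * e'.1 :: t ++ e'.2 :: w)) c u v w.
    under [RHS]eq_bigr do rewrite split3d_sum.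
    by rewrite split3d_sum.
  rewrite linear_sum -!big_split; apply: eq_bigr => e _.
  rewrite linear_sum -!big_split; apply: eq_bigr => e' _.
  by rewrite /= hochD_rgenE ?nonempty_cat // hochd_two_blocks.
transitivity (\sum_(p <- splits r) \sum_(q <- splits p.1)
  (hochd (fun a s => wd a s b t c q.1 q.2 p.2) a s
   + hochd (fun b t => wd a s b t c q.1 q.2 p.2) b t
   + split3d D (wd a s b t) c q.1 q.2 p.2
   + (l1 q.1 q.2 p.2 + r1 q.1 q.2 p.2) + (l2 q.1 q.2 p.2 + r2 q.1 q.2 p.2))).
  apply: eq_bigr => p _; rewrite linear_sum; apply: eq_bigr => q _; exact: step.
under [LHS]eq_bigr do rewrite !big_split /=.
rewrite !big_split /= hochd_splits3.
have -> : \sum_(p <- splits r) \sum_(q <- splits p.1)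
    hochd (fun a s => wd a s b t c q.1 q.2 p.2) a s =
    hochd (fun a s => insert2_word a s b t c r) a s.
  by rewrite hochd_sum; apply: eq_bigr => p _; rewrite hochd_sum.
have -> : \sum_(p <- splits r) \sum_(q <- splits p.1)
    hochd (fun b t => wd a s b t c q.1 q.2 p.2) b t =
    hochd (fun b t => insert2_word a s b t c r) b t.
  by rewrite hochd_sum; apply: eq_bigr => p _; rewrite hochd_sum.
have -> : \sum_(p <- splits r) \sum_(q <- splits p.1) l1 q.1 q.2 p.2
    + \sum_(p <- splits r) \sum_(q <- splits p.1) r1 q.1 q.2 p.2 =
    \sum_(p <- splits r) \sum_(e' <- E)
         prod_word a s c (p.1 ++ b * e'.1 :: t ++ e'.2 :: p.2)
    + \sum_(e <- E) insert_word (a * b * e.1) (s ++ e.2 :: t) c r.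
  rewrite [X in _ = _ + X]exchange_big -!big_split; apply: eq_bigr => p _ /=.
  rewrite -big_split /=.
  rewrite (sum_splits_telescope (l := fun u v => l1 u v p.2)
    (r := fun u v => r1 u v p.2)) => [|u z v].
    rewrite /l1 /r1 /=; congr (_ + _).
      rewrite exchange_big; apply: eq_bigr => e' _; rewrite prod_wordE.
      by apply: eq_bigr => e _; rewrite add0r.
    rewrite exchange_big [RHS]exchange_big; apply: eq_bigr => e' _.
    under eq_bigr do rewrite add0r.
    (* At a collision the factor [b * e'.1] moves to the left end of the first block: [e] is then
       the Casimir element inside the product, and [e'] the one enclosing it. *)
    rewrite -(casimir_rotate Ecas (f := fun x y =>
      rgen c (p.1 ++ x :: s ++ y :: t ++ e'.2 :: p.2))).
      apply: eq_bigr => e _; rewrite -catA; congr (rgen c (_ ++ _ :: _)).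
      by rewrite (mulrACA b) (mulrC b) (mulrC e'.1) !mulrA.
    exact: bilin_block (slotwise_rgen c).
  rewrite /l1 /r1; under eq_bigr do
    under eq_bigr do rewrite lmerge_rcons at_end_rcons addr0.
  under [RHS]eq_bigr do under eq_bigr do rewrite addr0 /=.
  apply: (casimir_rotate Ecas (f := fun x y => \sum_(e' <- E)
    rgen c (u ++ x :: s ++ y :: v ++ b * e'.1 :: t ++ e'.2 :: p.2))).
  apply: bilin_sum => e'; exact: bilin_block (slotwise_rgen c).
have -> : \sum_(p <- splits r) \sum_(q <- splits p.1) l2 q.1 q.2 p.2
    + \sum_(p <- splits r) \sum_(q <- splits p.1) r2 q.1 q.2 p.2 =
    \sum_(p <- splits r) \sum_(e <- E)
         prod_word c (p.1 ++ a * e.1 :: s ++ e.2 :: p.2) b t.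
  rewrite !sum_splits_assoc -!big_split; apply: eq_bigr => p _ /=; rewrite -big_split /=.
  rewrite sum_splits_telescope => [|v z w].
    rewrite /l2 /r2 /= [X in X + _]big1 => [|e _]; last by rewrite big1.
    rewrite add0r; apply: eq_bigr => e _; under eq_bigr do rewrite add0r.
    rewrite (casimir_swap Ecas (f := fun x y =>
      rgen (y * c) (p.1 ++ a * e.1 :: s ++ e.2 :: p.2 ++ x :: t))).
      apply: eq_bigr => e' _; rewrite -!catA /= -catA; congr rgen.
      by rewrite mulrAC (mulrC b).
    split=> x; last exact: linear_comp_fun (rgen_head _) (linear_mulr c).
    apply: (slotwise_linear (f := fun r =>
      rgen (x * c) (p.1 ++ a * e.1 :: s ++ e.2 :: r))).
    exact: slotwise_after2 (slotwise_rgen _).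
  rewrite /l2 /r2; apply: eq_bigr => e _.
  under eq_bigr do rewrite lmerge_rcons.
  under [RHS]eq_bigr do rewrite addr0 /=.
  apply: (casimir_rotate Ecas (f := fun x y =>
    rgen c (p.1 ++ a * e.1 :: s ++ e.2 :: v ++ x :: t ++ y :: w))).
  apply: (bilin_block (f := fun r => rgen c (p.1 ++ a * e.1 :: s ++ e.2 :: r))).
  exact: slotwise_after2 (slotwise_rgen c).
by char2.
Qed.

End DoubleInsertion.

Section LiftDifferential.
Variables (A : comAlgType 'F_2) (D : dg_algebra A) (W : lmodType 'F_2).
Local Notation d := (diff D).

Section Two.
Variable X : A -> seq A -> A -> seq A -> W.
Hypothesis Xc : chainwise2 X.

Lemma rlift2_hochDl a s b t : s != [::] -> t != [::] ->
  rlift2 X (hochD D (rgen a s)) (rgen b t) = hochd d (fun c r => X c r b t) a s.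
Proof. by move=> s0 t0; rewrite rlift2_rgenr // rlift_hochD //; case: Xc. Qed.

Lemma rlift2_hochDr a s b t : s != [::] -> t != [::] ->
  rlift2 X (rgen a s) (hochD D (rgen b t)) = hochd d (X a s) b t.
Proof. by move=> s0 t0; rewrite rlift2_rgenl // rlift_hochD //; case: Xc. Qed.

Lemma rlift2_bilin : bilin (rlift2 X).
Proof. by split=> x; [exact: rlift2_linearl|exact: rlift2_linearr]. Qed.

End Two.

Section Three.
Variable X : A -> seq A -> A -> seq A -> A -> seq A -> W.
Hypothesis Xc : chainwise3 X.

Lemma rlift3_hochD1 a s b t c r : s != [::] -> t != [::] -> r != [::] ->
  rlift3 X (hochD D (rgen a s)) (rgen b t) (rgen c r) =
  hochd d (fun a s => X a s b t c r) a s.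
Proof. by move=> s0 t0 r0; rewrite rlift3_rgen23 // rlift_hochD //; case: Xc. Qed.

Lemma rlift3_hochD2 a s b t c r : s != [::] -> t != [::] -> r != [::] ->
  rlift3 X (rgen a s) (hochD D (rgen b t)) (rgen c r) =
  hochd d (fun b t => X a s b t c r) b t.
Proof. by move=> s0 t0 r0; rewrite rlift3_rgen1 // rlift2_hochDl //; case: Xc. Qed.

Lemma rlift3_hochD3 a s b t c r : s != [::] -> t != [::] -> r != [::] ->
  rlift3 X (rgen a s) (rgen b t) (hochD D (rgen c r)) = hochd d (X a s b t) c r.
Proof. by move=> s0 t0 r0; rewrite rlift3_rgen1 // rlift2_hochDr //; case: Xc. Qed.

Lemma rlift3_bilin x : bilin (rlift3 X x).
Proof. by split=> y; [exact: rlift3_linear2|exact: rlift3_linear3]. Qed.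

End Three.

End LiftDifferential.

Lemma linear_fun_add (U W : lmodType 'F_2) (f g : U -> W) :
  linear f -> linear g -> linear (fun x => f x + g x).
Proof. by move=> fl gl c x y; rewrite fl gl scalerDr addrACA. Qed.

(** * Homotopies on the relative Hochschild complex *)

Section ChainIdentities.
Variables (A : comAlgType 'F_2) (D : dg_algebra A) (E : seq (A * A)).
Hypothesis Ecas : casimir D E.
Local Notation rgen := (@rgen A).
Local Notation prod_word := (prod_word E).

Local Notation insert_word := (insert_word E).
Local Notation rotated_insert_word := (rotated_insert_word E).
Local Notation insert2_word := (insert2_word E).
Local Notation "x * y" := (rlift2 prod_word x y) : chain_scope.
Local Delimit Scope chain_scope with C.
Local Notation del := (hochD D).
Local Notation B := (@connes A).

(** The terms of the Connes operator on a product whose cut falls in the bracket of the second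
    factor. *)
Definition rotated_prod_word a s b t : rchains A :=
  \sum_(p <- splits t) \sum_(e <- E) rgen 1 (p.2 ++ b * (a * e.1) :: s ++ e.2 :: p.1).

Lemma rotated_prod_word_chainwise : chainwise2 rotated_prod_word.
Proof.
have sl := @slotwise_rgen A.
split=> [a s|b t].
  apply: (chainwise_splits (phi := fun b u v => \sum_(e <- E)
    rgen 1 (v ++ b * (a * e.1) :: s ++ e.2 :: u))) => [u v|b v|b u].
  - apply: linear_sum_fun => e.
    exact: linear_comp_fun (slotwise_linear _ _ (sl _)) (linear_mulr _).
  - by apply: slotwise_sum => e; apply: slotwise_after2.
  - by apply: slotwise_sum => e; apply: slotwise_catr.
apply: chainwise_sum => p; apply: chainwise_sum => e; split=> u.
  apply: linear_comp_fun (slotwise_linear _ _ (sl _)) _.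
  exact: linear_comp_fun (linear_mull _) (linear_mulr _).
exact: slotwise_inside.
Qed.

Definition insertion := rlift2 insert_word.
Definition rotated_insertion := rlift2 rotated_insert_word.
Definition rotated_prod := rlift2 rotated_prod_word.
Definition insertion2 := rlift3 insert2_word.

Let pc := prod_word_chainwise E.
Let ic := insert_word_chainwise E.
Let rc := rotated_insert_word_chainwise E.
Let rpc := rotated_prod_word_chainwise.
Let ic2 := insert2_word_chainwise E.
Let hl := hochD_linear D.
Let cl := @connes_linear A.
Let pb := rlift2_bilin pc.
Let ib := rlift2_bilin ic.

Lemma hochD_prod x y : del (x * y)%C = (del x * y)%C + (x * del y)%C.
Proof.
move: x y; apply: rchains_ext2 => [||a s b t s0 t0].
- exact: bilin_comp pb hl.
- apply: bilinD; first exact: bilin_compl pb hl.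
  exact: bilin_compr pb hl.
- by rewrite rlift2_rgen // rlift2_hochDl // rlift2_hochDr // hochD_prod_word.
Qed.

Lemma prodA x y z : (x * (y * z))%C = ((x * y) * z)%C.
Proof.
move: x y z; apply: rchains_ext3 => [y z|x|y z|x|a s b t c r s0 t0 r0].
- exact: (proj1 pb).
- exact: bilin_comp pb (proj2 pb x).
- exact: linear_comp_fun (proj1 pb z) (proj1 pb y).
- exact: bilin_compl pb (proj2 pb x).
rewrite !rlift2_rgen // (lin_sum (proj2 pb _)) (lin_sum (proj1 pb _)).
under eq_bigr do rewrite rlift2_rgen ?nonempty_cat //.
under [RHS]eq_bigr do rewrite rlift2_rgen ?nonempty_cat //.
rewrite /prod_word exchange_big; apply: eq_bigr => e _; apply: eq_bigr => e' _.
rewrite -catA; congr (rgen _ _).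
by rewrite !mulrA [LHS]mulrAC (mulrAC _ c).
Qed.

Lemma hochD_ins x y : del (insertion x y) =
  insertion (del x) y + insertion x (del y) + ((x * y)%C + (y * x)%C).
Proof.
move: x y; apply: rchains_ext2 => [||a s b t s0 t0].
- exact: bilin_comp ib hl.
- apply: bilinD; last exact: bilinD pb (bilin_swap pb).
  apply: bilinD; first exact: bilin_compl ib hl.
  exact: bilin_compr ib hl.
- by rewrite /insertion !rlift2_rgen // rlift2_hochDl // rlift2_hochDr // hochD_insert_word.
Qed.

Lemma hochD_connes x : del (B x) = B (del x).
Proof.
move: x; apply: rchains_ext => [||a s s0].
- exact: linear_comp_fun hl cl.
- exact: linear_comp_fun cl hl.
rewrite connes_rgen // hochD_connes_word //.
by rewrite -(rlift_hochD _ _ (connes_word_chainwise A)).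
Qed.

(** The second rotation moves the leading unit into the bracket, where it is killed. *)
Lemma connes2 x : B (B x) = 0.
Proof.
move: x; apply: rchains_ext => [||a s s0].
- exact: linear_comp_fun cl cl.
- by move=> c x y; rewrite scaler0 addr0.
rewrite connes_rgen // (lin_sum cl) big1 // => i _.
rewrite connes_rgen ?nonempty_cat // /connes_word big1 // => j _.
exact: rgen_unit.
Qed.

(** A cut falls in one of the two brackets. For a cut in the bracket of [x], swapping the Casimir
    halves shows the term as one from the product in the opposite order. So B(x y) is symmetric
    already on chains. *)
Lemma connes_prod x y : B (x * y)%C = rotated_prod x y + rotated_prod y x.
Proof.
have rb := rlift2_bilin rpc.
move: x y; apply: rchains_ext2 => [||a s b t s0 t0].
- exact: bilin_comp pb cl.
- exact: bilinD rb (bilin_swap rb).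
rewrite /rotated_prod !rlift2_rgen // (lin_sum cl) addrC.
under eq_bigr => e _ do rewrite connes_rgen ?nonempty_cat // connes_wordE
  (sum_splits_cat (fun u v => rgen 1 (v ++ (a * b * e.1)%R :: u))).
rewrite big_split /=; congr (_ + _); rewrite exchange_big; apply: eq_bigr => p _.
  under eq_bigr do rewrite -catA /=.
  rewrite (casimir_swap Ecas (f := fun x y => rgen 1 (p.2 ++ y :: t ++ x :: p.1))).
    by apply: eq_bigr => e _; rewrite mulrA.
  exact/bilin_swap/bilin_block/slotwise_rgen.
by apply: eq_bigr => e _ /=; rewrite (mulrCA b) mulrA.
Qed.

Lemma hochD_rotins x y : del (rotated_insertion x y) =
  rotated_insertion (del x) y + rotated_insertion x (del y)
  + (insertion x y + (B y * x)%C + rotated_prod x y).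
Proof.
have rb := rlift2_bilin rc; have rpb := rlift2_bilin rpc.
move: x y; apply: rchains_ext2 => [||a s b t s0 t0].
- exact: bilin_comp rb hl.
- apply: bilinD; last apply: bilinD rpb; last apply: bilinD ib _.
    apply: bilinD; first exact: bilin_compl rb hl.
    exact: bilin_compr rb hl.
  exact: bilin_swap (bilin_compl pb cl).
rewrite /rotated_insertion /insertion /rotated_prod !rlift2_rgen //.
rewrite rlift2_hochDl // rlift2_hochDr //.
rewrite hochD_rotated_insert_word //; congr (_ + (_ + _ + _)).
rewrite connes_rgen // connes_wordE (lin_sum (proj1 pb _)); apply: eq_bigr => p _.
by rewrite rlift2_rgen ?nonempty_cat.
Qed.

Lemma ins_prodr x y z : insertion z (x * y)%C = (insertion z x * y)%C + (x * insertion z y)%C.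
Proof.
move: x y z; apply: rchains_ext3 => [y z|x|y z|x|a s b t c r s0 t0 r0].
- exact: linear_comp_fun (proj2 ib z) (proj1 pb y).
- exact: bilin_swap (bilin_compr ib (proj2 pb x)).
- apply: linear_fun_add; last exact: (proj1 pb).
  exact: linear_comp_fun (proj1 pb y) (proj2 ib z).
- apply: bilinD; last exact: bilin_comp (bilin_swap ib) (proj2 pb x).
  exact: bilin_swap (bilin_compl pb (proj1 ib x)).
rewrite /insertion !rlift2_rgen // (lin_sum (proj2 ib _)).
under eq_bigr => e _ do rewrite rlift2_rgen ?nonempty_cat //
  /insert_word (sum_splits_cat (fun u v => \sum_(e' <- E)
    rgen (a * b * e.1)%R (u ++ (c * e'.1)%R :: r ++ e'.2 :: v))).
rewrite big_split /= !(lin_sum (proj1 pb _)) (lin_sum (proj2 pb _)).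
congr (_ + _); rewrite exchange_big; apply: eq_bigr => p _.
  rewrite (lin_sum (proj1 pb _)) exchange_big; apply: eq_bigr => e _.
  rewrite rlift2_rgen ?nonempty_cat //; apply: eq_bigr => e' _.
  by rewrite -!catA /= -catA.
rewrite (lin_sum (proj2 pb _)) exchange_big; apply: eq_bigr => e _.
rewrite rlift2_rgen ?nonempty_cat //; apply: eq_bigr => e' _.
by rewrite -catA.
Qed.

Lemma hochD_ins2 x y z : del (insertion2 x y z) =
  insertion2 (del x) y z + insertion2 x (del y) z + insertion2 x y (del z)
  + (insertion (x * y)%C z + (x * insertion y z)%C + (insertion x z * y)%C).
Proof.
have i1 := rlift3_linear1 ic2; have i23 := rlift3_bilin ic2.
move: x y z; apply: rchains_ext3 => [y z|x|y z|x|a s b t c r s0 t0 r0].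
- exact: linear_comp_fun hl (i1 y z).
- exact: bilin_comp (i23 x) hl.
- apply: linear_fun_add; do 2?apply: linear_fun_add.
  + exact: linear_comp_fun (i1 y z) hl.
  + exact: i1.
  + exact: i1.
  + exact: linear_comp_fun (proj1 ib z) (proj1 pb y).
  + exact: (proj1 pb).
  + exact: linear_comp_fun (proj1 pb y) (proj1 ib z).
- apply: bilinD; do 2?apply: bilinD.
  + exact: i23.
  + exact: bilin_compl (i23 x) hl.
  + exact: bilin_compr (i23 x) hl.
  + exact: bilin_compl ib (proj2 pb x).
  + exact: bilin_comp ib (proj2 pb x).
  + exact: bilin_swap (bilin_compl pb (proj2 ib x)).
rewrite /insertion2 /insertion !rlift3_rgen // rlift3_hochD1 // rlift3_hochD2 //.
rewrite rlift3_hochD3 //.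
rewrite !rlift2_rgen // hochD_insert2_word //; congr (_ + (_ + _ + _)).
- rewrite (lin_sum (proj1 ib _)); apply: eq_bigr => e _.
  by rewrite rlift2_rgen ?nonempty_cat.
- rewrite (lin_sum (proj2 pb _)); apply: eq_bigr => p _.
  rewrite (lin_sum (proj2 pb _)); apply: eq_bigr => e _.
  by rewrite rlift2_rgen ?nonempty_cat.
- rewrite (lin_sum (proj1 pb _)); apply: eq_bigr => p _.
  rewrite (lin_sum (proj1 pb _)); apply: eq_bigr => e _.
  by rewrite rlift2_rgen ?nonempty_cat.
Qed.

End ChainIdentities.

(** * Gradings *)

Section LinearSpan.
Variables (K : nzRingType) (V : lmodType K) (G : V -> Prop).

Lemma lspan_comb c u v : lspan G u -> lspan G v -> lspan G (c *: u + v).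
Proof.
move=> su sv; have [_ sub] := lspan_submod G.
by apply/asboolP/(sub c); apply/asboolP.
Qed.

Lemma lspanD u v : lspan G u -> lspan G v -> lspan G (u + v).
Proof. by move=> su sv; rewrite -[u]scale1r; apply: lspan_comb. Qed.

Lemma lspan_sum I (r : seq I) (P : pred I) (f : I -> V) :
  (forall i, P i -> lspan G (f i)) -> lspan G (\sum_(i <- r | P i) f i).
Proof. by move=> fG; apply: big_ind => //; [exact: lspan_zero|exact: lspanD]. Qed.

End LinearSpan.

Lemma lspan_linear (U V : lmodType 'F_2) (G : U -> Prop) (H : V -> Prop) (f : U -> V) :
  linear f -> (forall u, G u -> lspan H (f u)) -> forall u, lspan G u -> lspan H (f u).
Proof.
move=> fl fG u; elim=> [|c v w Gv _ IH]; first by rewrite (lin0 fl); exact: lspan_zero.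
by rewrite fl; apply: lspan_comb => //; exact: fG.
Qed.

Section GradedDecomposition.
Variables (V : lmodType 'F_2) (gr : int -> V -> Prop).
Hypotheses (gr0 : forall i, gr i 0)
  (gr_comb : forall i c u v, gr i u -> gr i v -> gr i (c *: u + v)).

Lemma gr_sum I (r : seq I) (P : pred I) i (f : I -> V) :
  (forall k, P k -> gr i (f k)) -> gr i (\sum_(k <- r | P k) f k).
Proof.
move=> fg; apply: big_ind => // u v gu gv.
by rewrite -[u]scale1r; exact: gr_comb.
Qed.

Lemma homogeneous_decomposition (P : pred int) v :
    lspan (fun u => exists2 i, P i & gr i u) v ->
  exists (s : seq int) (f : int -> V),
    [/\ uniq s, all P s, forall i, gr i (f i), forall i, i \notin s -> f i = 0
      & v = \sum_(i <- s) f i].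
Proof.
elim=> [|c u w [i Pi gi] _ [s [f [us Ps fg f0 ->]]]].
  by exists [::], (fun=> 0); split=> //; rewrite big_nil.
exists (undup (i :: s)), (fun j => f j + (if j == i then c *: u else 0)).
split=> [|||j|].
- exact: undup_uniq.
- by apply/allP => j; rewrite mem_undup inE => /predU1P[->|/(allP Ps)].
- move=> j; rewrite -[f j]scale1r; apply: gr_comb => //.
  by case: eqP => [->|//]; rewrite -[c *: u]addr0; exact: gr_comb.
- rewrite mem_undup inE negb_or => /andP[/negPf-> /f0->].
  by rewrite addr0.
rewrite big_split addrC; congr (_ + _).
  rewrite /=; case: ifP => [i_s|i_s]; rewrite undup_id //.
  by rewrite big_cons f0 ?add0r ?i_s.
rewrite (bigD1_seq i) ?undup_uniq ?mem_undup ?mem_head //= eqxx.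
by rewrite big1 ?addr0 // => j /negPf->.
Qed.

End GradedDecomposition.

Section GradedProjection.
Variables (V : lmodType 'F_2) (gr : int -> V -> Prop).
Hypothesis gV : graded gr.

Lemma graded_span v : lspan (fun u => exists2 i, predT i & gr i u) v.
Proof.
case: gV => g0 gD gS _; have [s [f [fg ->]]] := gS v.
by apply: lspan_sum => i _; apply: lspan_gen; exists i.
Qed.

Lemma graded_uniq_decomposition v : exists (s : seq int) (f : int -> V),
  [/\ uniq s, forall i, gr i (f i), forall i, i \notin s -> f i = 0 & v = \sum_(i <- s) f i].
Proof.
case: gV => g0 gD _ _; have [s [f [us _ fg f0 vE]]] :=
  homogeneous_decomposition g0 gD (graded_span v).
by exists s, f; split.
Qed.

(** The grading only asserts that decompositions exist and are independent. The component is chosen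
    through the relation [R], and its uniqueness makes the choice linear. *)
Lemma graded_projection : exists p : int -> V -> V,
  [/\ forall i, linear (p i), forall i v, gr i v -> p i v = v
    & forall i j v, gr j v -> j != i -> p i v = 0].
Proof.
case: gV => g0 gD gS gI.
pose R i v w := gr i w /\ lspan (fun u => exists2 j, j != i & gr j u) (v - w).
have Rex i v : exists w, R i v w.
  have [s [f [fg ->]]] := gS v; exists (\sum_(j <- s | j == i) f j); split.
    by apply: gr_sum => // j /eqP->.
  rewrite [X in X - _](bigID (pred1 i)) /= addrAC subrr add0r.
  by apply: lspan_sum => j ji; apply: lspan_gen; exists j.
have Runiq i v w w' : R i v w -> R i v w' -> w = w'.
  move=> [gw sw] [gw' sw']; apply/eqP; rewrite -subr_eq0; apply/eqP.
  have gd : gr i (w' - w) by rewrite addrC -scaleN1r; exact: gD.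
  have sd : lspan (fun u => exists2 j, predC1 i j & gr j u) (w - w').
    have -> : w - w' = (-1) *: (v - w) + (v - w').
      by rewrite scaleN1r opprB addrA subrK.
    exact: lspan_comb.
  have [s [f [us Ps fg _ dE]]] := homogeneous_decomposition g0 gD sd.
  have i_s : i \notin s by apply/negP => /(allP Ps); rewrite /= eqxx.
  (* Two candidates [w] and [w'] give a vanishing sum of [w' - w] in degree [i] and of the
     components of [w - w'] in other degrees; independence applies. *)
  have /= := gI (i :: s) (fun j => if j == i then w' - w else f j).
  rewrite i_s us => /(_ isT) H.
  rewrite -opprB; apply/eqP; rewrite oppr_eq0; apply/eqP.
  have := H _ _ i; rewrite eqxx mem_head; apply=> //.
    by move=> j; case: eqP => [->|].
  rewrite big_cons eqxx (eq_big_seq f); first by rewrite -dE addrC subrKA subrr.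
  by move=> j js; case: eqP => // ji; rewrite ji (negPf i_s) in js.
pose p i v := projT1 (cid (Rex i v)).
have pR i v : R i v (p i v) by exact: (projT2 (cid (Rex i v))).
exists p; split=> [i c u v|i v gv|i j v gv ji].
- apply: Runiq (pR _ _) _; have [gu su] := pR i u; have [gv sv] := pR i v.
  split; first exact: gD.
  by rewrite opprD addrACA -scalerBr; exact: lspan_comb.
- by apply: Runiq (pR _ _) _; split=> //; rewrite subrr; exact: lspan_zero.
- apply: Runiq (pR _ _) _; split=> //; rewrite subr0; apply: lspan_gen.
  by exists j.
Qed.

Lemma shift_graded r : graded (shift_gr gr r).
Proof.
case: gV => g0 gD gS gI; rewrite /shift_gr; split=> [i|i c u v|v|s f us fg f0 i i_s].
- exact: g0.
- exact: gD.
- have [s [f [fg ->]]] := gS v.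
  exists [seq i + r | i <- s], (fun j => f (j - r)); split=> [i|]; first exact: fg.
  by rewrite big_map; apply: eq_bigr => i _; rewrite addrK.
- have := gI [seq j - r | j <- s] (fun j => f (j + r)).
  have inj : injective (fun j : int => j - r) by move=> x y /addIr.
  rewrite map_inj_uniq // => /(_ us) H; rewrite -[i](subrK r).
  apply: H; first by move=> j; have := fg (j + r); rewrite addrK.
    by rewrite big_map -[RHS]f0; apply: eq_bigr => j _; rewrite subrK.
  exact: map_f.
Qed.

End GradedProjection.

Section Homology.
Variables (C : lmodType 'F_2) (d : {linear C -> C}).

Lemma dcycle_val_comb c (z z' : dcycle d) :
  dcycle_val (c *: z + z') = c *: dcycle_val z + dcycle_val z'.
Proof. exact: (linearP (val : dcycle d -> C)). Qed.

Lemma dcycle_val0 : dcycle_val (0 : dcycle d) = 0.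
Proof. exact: (raddf0 (val : dcycle d -> C)). Qed.

Lemma dcycle_valB (z z' : dcycle d) :
  dcycle_val (z - z') = dcycle_val z - dcycle_val z'.
Proof. exact: (raddfB (val : dcycle d -> C)). Qed.

Lemma dcycle_val_sum I (r : seq I) (z : I -> dcycle d) :
  dcycle_val (\sum_(i <- r) z i) = \sum_(i <- r) dcycle_val (z i).
Proof. exact: (raddf_sum (val : dcycle d -> C)). Qed.

Lemma dcycleK (z : dcycle d) : d (dcycle_val z) = 0.
Proof. by case: z => v /= /eqP. Qed.

Lemma kerdP v : d v = 0 -> v \in kerd d.
Proof. by move=> dv; rewrite unfold_in dv. Qed.

Lemma hclass_comb c (z z' : dcycle d) : hclass (c *: z + z') = c *: hclass z + hclass z'.
Proof. exact: (linearP (to_modq (@boundary _ C d))). Qed.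

Lemma hclass_sum I (r : seq I) (z : I -> dcycle d) :
  hclass (\sum_(i <- r) z i) = \sum_(i <- r) hclass (z i).
Proof. exact: (raddf_sum (to_modq (@boundary _ C d))). Qed.

Lemma hclass_eqP (z z' : dcycle d) :
  hclass z = hclass z' <-> exists c, dcycle_val z - dcycle_val z' = d c.
Proof.
rewrite /hclass to_modq_eqP -dcycle_valB; split=> [|[c dc]].
  elim=> [|c u v [b ub] _ [e ve]]; first by exists 0; rewrite dcycle_val0 linear0.
  by exists (c *: b + e); rewrite dcycle_val_comb ub ve linearP.
by apply: lspan_gen; exists c.
Qed.

Lemma hclass_surj (h : homology d) : exists z, h = hclass z.
Proof. by exists (repr (h : modq _)); rewrite /hclass to_modqK. Qed.

Lemma hclass0 : hclass (0 : dcycle d) = 0.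
Proof. exact: (raddf0 (to_modq (@boundary _ C d))). Qed.

Variable gr : int -> C -> Prop.
Hypotheses (gC : graded gr) (d_gr : forall i v, gr i v -> gr (i + 1) (d v)).

(** As [d] is homogeneous, the components of a cycle are cycles, and a bounding chain of a sum of
    homogeneous cycles bounds them degree by degree. *)
Lemma homology_graded :
  graded (fun j (h : homology d) => exists z : dcycle d, gr j (dcycle_val z) /\ h = hclass z).
Proof.
have [p [pl pid p0]] := graded_projection gC; have [g0 gD _ _] := gC.
split=> [i|i c u v [z [gz ->]] [z' [gz' ->]]|h|s h us hg h0 i i_s].
- by exists 0; rewrite dcycle_val0 hclass0.
- by exists (c *: z + z'); rewrite dcycle_val_comb hclass_comb; split=> //; exact: gD.
- have [z ->] := hclass_surj h; have [s [f [us fg f0 zE]]] :=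
    graded_uniq_decomposition gC (dcycle_val z).
  have df i : d (f i) = 0.
    have [i_s|/f0->] := boolP (i \in s); last by rewrite linear0.
    have := dcycleK z; rewrite zE linear_sum => /(congr1 (p (i + 1))).
    rewrite (lin0 (pl _)) (lin_sum (pl _)) (bigD1_seq i) //= pid; last exact: d_gr.
    rewrite big1 ?addr0 // => j ji; apply: p0 (d_gr (fg j)) _.
    by rewrite (inj_eq (addIr 1)).
  pose zf i := DCycle (kerdP (df i)).
  exists s, (fun i => hclass (zf i)); split=> [i|]; first by exists (zf i).
  rewrite -hclass_sum; congr hclass; apply: val_inj.
  by rewrite /= dcycle_val_sum zE.
- have /choice[z zP] := hg.
  have : hclass (\sum_(j <- s) z j) = hclass 0.
    by rewrite hclass_sum hclass0 -[RHS]h0; apply: eq_bigr => j _; case: (zP j).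
  move/hclass_eqP => [c]; rewrite dcycle_val0 subr0 dcycle_val_sum.
  have [t [g [ut gg g_0 ->]]] := graded_uniq_decomposition gC c.
  move/(congr1 (p i)); rewrite linear_sum !(lin_sum (pl i)) (bigD1_seq i) //=.
  rewrite pid; last by case: (zP i).
  rewrite big1 ?addr0 => [zi|j ji]; last by apply: p0 ji; case: (zP j).
  rewrite (proj2 (zP i)) -hclass0; apply/hclass_eqP; rewrite dcycle_val0 subr0 zi.
  (* The component of [c] one degree below [i], written as a filtered sum because [t] need not
     contain that degree. *)
  exists (\sum_(j <- t | j + 1 == i) g j); rewrite linear_sum [RHS]big_mkcond /=.
  apply: eq_bigr => j _; case: eqP => [<-|/eqP ji]; first exact: pid (d_gr _).
  exact: p0 (d_gr (gg j)) ji.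
Qed.

End Homology.

(** * The grading of the relative Hochschild complex *)

Section GradedChains.
Variables (A : comAlgType 'F_2) (D : dg_algebra A).
Local Notation d := (diff D).
Local Notation gr := (gr D).
Implicit Types (k i j l : int) (s t : seq A).

(* The bracket [s] has homogeneous entries of total degree k, each entry
   counting with its degree minus 1. *)
Fixpoint word_gr (k : int) (s : seq A) : Prop :=
  if s is x :: s' then exists2 i, gr i x & word_gr (k - i + 1) s' else k = 0.

Lemma word_gr_cat k s t :
  word_gr k (s ++ t) <-> exists2 l, word_gr l s & word_gr (k - l) t.
Proof.
elim: s k => [|x s IH] k /=.
  by split=> [kt|[l ->]]; [exists 0; rewrite ?subr0|rewrite subr0].
split=> [[i gi /IH[l ls lt]]|[l [i gi ls] lt]].
  exists (l + i - 1); last by move: lt; congr word_gr; lia.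
  by exists i => //; move: ls; congr word_gr; lia.
by exists i => //; apply/IH; exists (l - i + 1) => //; move: lt; congr word_gr; lia.
Qed.

Lemma word_grP k s : word_gr k s <-> exists i : nat -> int,
  (forall l : nat, (l < size s)%N -> gr (i l) s`_l) /\ k = \sum_(l < size s) i l - (size s)%:Z.
Proof.
elim: s k => [|x s IH] k /=.
  split=> [->|[i [_ ->]]]; last by rewrite big_ord0.
  by exists (fun=> 0); rewrite big_ord0.
split=> [[i gi /IH[f [fg kE]]]|[f [fg kE]]].
  exists (fun l => if l is l'.+1 then f l' else i); split=> [[|l]|] //.
    exact: fg.
  rewrite (_ : \sum_(l < _) _ = i + \sum_(l < size s) f l); first by move: kE; lia.
  by rewrite big_ord_recl; congr (_ + _); apply: eq_bigr.
exists (f 0%N); first exact: (fg 0%N).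
apply/IH; exists (f \o succn); split=> [l ls|]; first exact: (fg l.+1).
rewrite kE (_ : \sum_(l < _) _ = f 0%N + \sum_(l < size s) f l.+1) /=; first lia.
by rewrite big_ord_recl; congr (_ + _); apply: eq_bigr.
Qed.

Lemma rchains_gr_gen k a s i : gr i a -> word_gr (k - i) s -> rchains_gr D k (rgen a s).
Proof.
move=> ga /word_grP[f [fg kE]]; apply: lspan_gen; exists a, s, i, f; split=> //.
by rewrite -addrA -kE addrC subrK.
Qed.

Lemma rchains_gr_ind (P : rchains A -> Prop) k :
    P 0 -> (forall c x y, P x -> P y -> P (c *: x + y)) ->
    (forall a s i, gr i a -> word_gr (k - i) s -> P (rgen a s)) ->
  forall x, rchains_gr D k x -> P x.
Proof.
move=> P0 PD Pg x; elim=> // c u v [a [s [i0 [i [ga sg kE ->]]]]] _ Pv.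
apply: PD => //; apply: (Pg _ _ i0) => //; apply/word_grP; exists i; split=> //.
by rewrite kE addrC !addrA addNr add0r.
Qed.

Lemma rchains_gr_comb k c x y :
  rchains_gr D k x -> rchains_gr D k y -> rchains_gr D k (c *: x + y).
Proof. exact: lspan_comb. Qed.

Section Projection.
Variable p : int -> A -> A.
Hypotheses (pl : forall i, linear (p i)) (pid : forall i v, gr i v -> p i v = v)
  (p0 : forall i j v, gr j v -> j != i -> p i v = 0).

(* The component of degree k of a word, truncated to letters with degrees in
   the finite list I: a projection that needs no infinite sum. *)
Fixpoint word_proj (W : lmodType 'F_2) (I : seq int) (k : int) (f : seq A -> W) s : W :=
  if s is x :: s' then
    \sum_(i <- I) word_proj I (k - i + 1) (fun r => f (p i x :: r)) s'
  else if k == 0 then f [::] else 0.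

Section WordProj.
Variables (W : lmodType 'F_2) (I : seq int).
Implicit Type f : seq A -> W.

Lemma word_proj_linear k (G : A -> seq A -> W) s :
  (forall r, linear (G^~ r)) -> linear (fun a => word_proj I k (G a) s).
Proof.
elim: s k G => [|x s IH] k G Gl /=.
  by case: (k == 0) => //; move=> c a b; rewrite scaler0 addr0.
by apply: linear_sum_fun => i; apply: (IH _ (fun a r => G a (p i x :: r))).
Qed.

Lemma word_proj0 k f s : (forall r, f r = 0) -> word_proj I k f s = 0.
Proof.
elim: s k f => [|x s IH] k f f0 /=; first by rewrite f0; case: ifP.
by rewrite big1 // => i _; apply: IH.
Qed.

Lemma slotwise0 f t : slotwise f -> f (0 :: t) = 0.
Proof. by move=> fs; apply: (lin0 (slotwise_linear0 t fs)). Qed.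

Lemma word_proj_slotwise k f : slotwise f -> slotwise (word_proj I k f).
Proof.
move=> fs; split=> s t; elim: s k f fs => [|y s IH] k f fs /=.
- apply: linear_sum_fun => i.
  apply: (linear_comp_fun (f := fun x => word_proj I (k - i + 1) (fun r => f (x :: r)) t))
    (pl i).
  apply: (@word_proj_linear _ (fun x r => f (x :: r))) => r.
  exact: slotwise_linear0.
- by apply: linear_sum_fun => i; apply/IH/slotwise_cons.
- rewrite big1 // => i _; apply: word_proj0 => r.
  (* The unit is homogeneous of degree 0, so each of its components is 0 or the unit, and either
     kills the word. *)
  have [<-|i0] := eqVneq 0 i; last by rewrite (p0 (gr_one D) i0) slotwise0.
  by rewrite (pid (gr_one D)); case: fs => _ f1; rewrite (f1 [::]).
- by rewrite big1 // => i _; apply/IH/slotwise_cons.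
Qed.

Lemma word_proj_neq k l f s : slotwise f -> word_gr l s -> l != k -> word_proj I k f s = 0.
Proof.
elim: s k l f => [|x s IH] k l f fs /=; first by move=> -> /negPf; rewrite eq_sym => ->.
move=> [j gj ls] lk; rewrite big1 // => i _.
have [ji|ji] := eqVneq j i; last first.
  by apply: word_proj0 => r; rewrite (p0 gj ji) slotwise0.
apply: (IH _ (l - j + 1)) => //; first exact: slotwise_cons.
by rewrite ji; move: lk; apply: contra_neq; lia.
Qed.

End WordProj.

(** The list must contain the degrees of all letters, without repetition since a repeated degree
    would be counted twice. *)
Lemma word_proj_id k s : word_gr k s ->
  exists I0 : seq int, forall (I : seq int) (W : lmodType 'F_2) (f : seq A -> W),
    uniq I -> {subset I0 <= I} -> slotwise f -> word_proj I k f s = f s.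
Proof.
elim: s k => [|x s IH] k /= => [->|[i gi /IH[I0 idI]]]; first by exists [::].
exists (i :: I0) => I W f uI sI fs.
rewrite (bigD1_seq i) ?sI ?mem_head //= pid // idI //; last exact: slotwise_cons.
  rewrite big1 ?addr0 // => j ji; apply: word_proj0 => r.
  by rewrite (p0 gi) ?slotwise0 // eq_sym.
by move=> j jI; rewrite sI // inE jI orbT.
Qed.

Definition chain_proj_word I k a s : rchains A :=
  \sum_(i <- I) word_proj I (k - i) (rgen (p i a)) s.

Lemma chain_proj_chainwise I k : chainwise (chain_proj_word I k).
Proof.
apply: chainwise_sum => i; split=> [s|a].
  apply: (linear_comp_fun (f := fun x => word_proj I (k - i) (rgen x) s)) (pl i).
  apply: word_proj_linear; exact: rgen_head.
exact/word_proj_slotwise/slotwise_rgen.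
Qed.

Definition chain_proj I k := rlift (chain_proj_word I k).

Lemma chain_proj_linear I k : linear (chain_proj I k).
Proof. exact/rlift_linear_chainwise/chain_proj_chainwise. Qed.

Lemma chain_proj_neq I k l x : rchains_gr D l x -> l != k -> chain_proj I k x = 0.
Proof.
have cl := chain_proj_linear I k; move=> gx lk; move: x gx; apply: rchains_gr_ind.
- exact: lin0.
- by move=> c x y x0 y0; rewrite cl x0 y0 scaler0 addr0.
move=> a s j ga gs; have [->|s0] := eqVneq s [::]; first by rewrite rgen_nil lin0.
rewrite /chain_proj (rlift_chainwise _ (chain_proj_chainwise I k)) //.
rewrite /chain_proj_word big1 // => i _; have [ji|ji] := eqVneq j i; last first.
  by apply: word_proj0 => r; rewrite (p0 ga ji) (lin0 (rgen_head r)).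
apply: (word_proj_neq _ (slotwise_rgen _) gs).
by rewrite ji; move: lk; apply: contra_neq; lia.
Qed.

Lemma chain_proj_id k x : rchains_gr D k x -> exists I, chain_proj I k x = x.
Proof.
(* Uniformity in [I] lets the lists of two summands be joined. *)
suff H : rchains_gr D k x -> exists I0 : seq int, forall I : seq int,
    uniq I -> {subset I0 <= I} -> chain_proj I k x = x.
  move=> /H[I0 idI]; exists (undup I0); apply: idI; first exact: undup_uniq.
  by move=> i; rewrite mem_undup.
move: x; apply: rchains_gr_ind.
- by exists [::] => I _ _; rewrite (lin0 (chain_proj_linear I k)).
- move=> c x y [I1 id1] [I2 id2]; exists (I1 ++ I2) => I uI sI.
  rewrite chain_proj_linear id1 ?id2 // => i iI; apply: sI; rewrite mem_cat iI ?orbT //.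
move=> a s j ga gs; have [I0 idI] := word_proj_id gs; exists (j :: I0) => I uI sI.
have [->|s0] := eqVneq s [::]; first by rewrite rgen_nil (lin0 (chain_proj_linear I k)).
rewrite /chain_proj (rlift_chainwise _ (chain_proj_chainwise I k)) //.
rewrite /chain_proj_word (bigD1_seq j) ?sI ?mem_head //= pid // idI //; last first.
- exact: slotwise_rgen.
- by move=> i iI; rewrite sI // inE iI orbT.
rewrite big1 ?addr0 // => i ij; apply: word_proj0 => r.
by rewrite (p0 ga) ?(lin0 (rgen_head r)) // eq_sym.
Qed.

End Projection.

Lemma word_span (f : seq A -> rchains A) (P : rchains A -> Prop) s : slotwise f ->
    (forall k r, word_gr k r -> lspan P (f r)) ->
  lspan P (f s).
Proof.
elim: s f => [|x s IH] f fs fP; first exact: (fP 0).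
have [_ _ gS _] := gr_graded D; have [t [g [gg ->]]] := gS x.
rewrite (lin_sum (slotwise_linear0 s fs)); apply: lspan_sum => i _.
apply: (IH (fun r => f (g i :: r))) => [|k r kr]; first exact: slotwise_cons.
by apply: (fP (k + i - 1)); exists i => //; move: kr; congr word_gr; lia.
Qed.

Lemma rchains_graded : graded (@rchains_gr A D).
Proof.
split=> [i|i c u v|v|s f us fg f0 i i_s].
- exact: lspan_zero.
- exact: rchains_gr_comb.
- suff sv : lspan (fun u => exists2 i, predT i & rchains_gr D i u) v.
    have [s [f [_ _ fg _ ->]]] := homogeneous_decomposition
      (fun i => lspan_zero _) (@rchains_gr_comb) sv.
    by exists s, f.
  move: v; apply: rchains_ind => [|c x y|a s _]; [exact: lspan_zero|exact: lspan_comb|].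
  have [_ _ gS _] := gr_graded D; have [t [g [gg ->]]] := gS a.
  rewrite (lin_sum (rgen_head s)); apply: lspan_sum => i _.
  apply: word_span (slotwise_rgen _) _ => k r kr; apply: lspan_gen.
  exists (i + k) => //; apply: (rchains_gr_gen (gg i)).
  by move: kr; congr word_gr; lia.
- have [p [pl pid p0]] := graded_projection (gr_graded D).
  (* The list is adapted to [f i] alone; elements of another degree are killed for every list. *)
  have [I idI] := chain_proj_id pl pid p0 (fg i).
  have := congr1 (chain_proj p I i) f0; have cl := chain_proj_linear pl pid p0 I i.
  rewrite (lin0 cl) (lin_sum cl) (bigD1_seq i) //= idI big1 ?addr0 // => j ji.
  exact: (chain_proj_neq pl pid p0 I (fg j)).
Qed.

Lemma bard_gr (P : rchains A -> Prop) (f : seq A -> rchains A) k s :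
    (forall r, word_gr (k + 1) r -> lspan P (f r)) -> word_gr k s ->
  lspan P (bard d f s).
Proof.
elim: s k f => [|x s IH] k f fP /=; first by move=> _; exact: lspan_zero.
move=> [i gi ks]; apply: lspanD; first apply: lspanD.
- apply: fP; exists (i + 1); first exact: diff_gr.
  by move: ks; congr word_gr; lia.
- case: s ks {IH} => [|y s] /=; first by move=> _; exact: lspan_zero.
  move=> [j gj ks]; apply: fP; exists (i + j); first exact: gr_mul.
  by move: ks; congr word_gr; lia.
- apply: (IH (k - i + 1)) => // r kr; apply: fP; exists i => //.
  by move: kr; congr word_gr; lia.
Qed.

Lemma hochD_gr k x : rchains_gr D k x -> rchains_gr D (k + 1) (hochD D x).
Proof.
have cl := hochD_linear D; move: x; apply: rchains_gr_ind.
- by rewrite (lin0 cl); exact: lspan_zero.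
- by move=> c x y gx gy; rewrite cl; exact: lspan_comb.
move=> a s i ga gs; have [->|s0] := eqVneq s [::].
  by rewrite rgen_nil (lin0 cl); exact: lspan_zero.
rewrite hochD_rgenE // hochdE; do 3?apply: lspanD.
- apply: (rchains_gr_gen (diff_gr ga)); by move: gs; congr word_gr; lia.
- apply: bard_gr gs => r kr; apply: (rchains_gr_gen ga).
  by move: kr; congr word_gr; lia.
- case: s gs {s0} => [|y s] /=; first by move=> _; exact: lspan_zero.
  move=> [j gj ks]; apply: (rchains_gr_gen (gr_mul ga gj)).
  by move: ks; congr word_gr; lia.
- case/lastP: s gs {s0} => [|s y]; first by move=> _; exact: lspan_zero.
  rewrite -cats1 => /word_gr_cat[l ls /= [j gj kj]].
  rewrite cats1 lmerge_rcons; apply: (rchains_gr_gen (gr_mul gj ga)).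
  by move: ls; congr word_gr; lia.
Qed.

(** The degree drops by one because the coefficient enters the bracket and is shifted there. *)
Lemma connes_gr k x : rchains_gr D k x -> rchains_gr D (k - 1) (connes x).
Proof.
have cl := @connes_linear A; move: x; apply: rchains_gr_ind.
- by rewrite (lin0 cl); exact: lspan_zero.
- by move=> c x y gx gy; rewrite cl; exact: lspan_comb.
move=> a s i ga gs; have [->|s0] := eqVneq s [::].
  by rewrite rgen_nil (lin0 cl); exact: lspan_zero.
rewrite connes_rgen //; apply: lspan_sum => j _; apply: (rchains_gr_gen (gr_one D)).
move: gs; rewrite -{1}(cat_take_drop j s) => /word_gr_cat[l lt ld].
apply/word_gr_cat; exists (k - i - l) => //=; exists i => //.
by move: lt; congr word_gr; lia.
Qed.

End GradedChains.

(** The coproduct contributes [m], and the new bracket letter contributes -1. *)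
Lemma rprod_word_gr (A : comAlgType 'F_2) (m : int) (F : open_frobenius A m)
    a s b t (i j k l : int) :
  gr F i a -> word_gr F (k - i) s -> gr F j b -> word_gr F (l - j) t ->
  rchains_gr F (k + l + m - 1) (rprod_word F a s b t).
Proof.
move=> ga gs gb gt; rewrite /rprod_word /coprod_sum.
have tb : bilin (fun u v : A => rgen u (s ++ v :: t)) by exact/bilin_cat/chainwise_rgen.
apply: (lspan_linear (tlift_linear_bilin tb)) (coprod_gr (gr_mul ga gb)).
move=> _ [i' [u [v [gu gv ->]]]]; case: tb => tl tr; rewrite tlift_tens //.
apply: (rchains_gr_gen gu); apply/word_gr_cat; exists (k - i) => //=.
by eexists; first exact: gv; move: gt; congr word_gr; lia.
Qed.

(** * The BV structure on homology *)

Section HomologyBV.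
Variables (A : comAlgType 'F_2) (D : dg_algebra A) (E : seq (A * A)).
Hypothesis Ecas : casimir D E.

Local Notation del := (hochD D).
Local Notation B := (@connes A).
Local Notation prod := (rlift2 (prod_word E)).
Local Notation ins := (insertion E).
Local Notation cycle := (dcycle del).

Let pb : bilin prod := rlift2_bilin (prod_word_chainwise E).
Let ib : bilin ins := rlift2_bilin (insert_word_chainwise E).

Section Closed.
Variables u v w : rchains A.
Hypotheses (du : del u = 0) (dv : del v = 0) (dw : del w = 0).

Lemma prod_closed : del (prod u v) = 0.
Proof. by rewrite (hochD_prod Ecas) du dv (lin0 (proj1 pb _)) (lin0 (proj2 pb _)) addr0. Qed.

Lemma connes_closed : del (B u) = 0.
Proof. by rewrite hochD_connes du (lin0 (@connes_linear A)). Qed.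

Lemma ins_closed : del (ins u v + ins v u) = 0.
Proof.
rewrite linearD /= !(hochD_ins Ecas) du dv !(lin0 (proj1 ib _)) !(lin0 (proj2 ib _)).
by char2.
Qed.

Lemma connes_bracket_boundary :
  ins u v + ins v u + (B (prod u v) + prod (B u) v + prod (B v) u) =
  del (rotated_insertion E u v + rotated_insertion E v u).
Proof.
have rb : bilin (rotated_insertion E) := rlift2_bilin (rotated_insert_word_chainwise E).
rewrite (connes_prod Ecas) linearD /= !(hochD_rotins Ecas) du dv.
by rewrite !(lin0 (proj1 rb _)) !(lin0 (proj2 rb _)); char2.
Qed.

Lemma ins_prod_boundary :
  ins (prod u v) w + ins w (prod u v)
  + (prod u (ins v w + ins w v) + prod (ins u w + ins w u) v) = del (insertion2 E u v w).
Proof.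
have i1 y z : linear (fun x => insertion2 E x y z) :=
  rlift3_linear1 (insert2_word_chainwise E) y z.
have i23 x : bilin (insertion2 E x) := rlift3_bilin (insert2_word_chainwise E) x.
rewrite (hochD_ins2 Ecas) du dv dw ins_prodr.
rewrite (lin0 (i1 _ _)) (lin0 (proj1 (i23 _) _)) (lin0 (proj2 (i23 _) _)).
by rewrite (linD (proj1 pb _)) (linD (proj2 pb _)); char2.
Qed.

End Closed.

Definition prodz (x y : cycle) : cycle :=
  DCycle (kerdP (prod_closed (dcycleK x) (dcycleK y))).
Definition connesz (x : cycle) : cycle := DCycle (kerdP (connes_closed (dcycleK x))).
Definition insz (x y : cycle) : cycle :=
  DCycle (kerdP (ins_closed (dcycleK x) (dcycleK y))).

Definition homology_mul (p q : HH D) : HH D :=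
  locked (hclass (prodz (repr (p : modq _)) (repr (q : modq _)))).
Definition homology_connes (p : HH D) : HH D :=
  locked (hclass (connesz (repr (p : modq _)))).

Local Notation mul := homology_mul.
Local Notation Delta := homology_connes.

Lemma hclass_repr (z : cycle) : hclass (repr (hclass z : modq _)) = hclass z.
Proof. exact: to_modqK. Qed.

Lemma hclass_prodz x x' y y' : hclass x = hclass x' -> hclass y = hclass y' ->
  hclass (prodz x y) = hclass (prodz x' y').
Proof.
move=> /hclass_eqP[c xc] /hclass_eqP[e ye].
(* From x y - x' y' = (x - x') y + x' (y - y'). *)
apply/hclass_eqP; exists (prod c (dcycle_val y) + prod (dcycle_val x') e).
rewrite linearD /= !(hochD_prod Ecas) !dcycleK (lin0 (proj1 pb _)) (lin0 (proj2 pb _)).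
rewrite addr0 add0r -xc -ye !subr2 (linD (proj1 pb _)) (linD (proj2 pb _)).
by rewrite addrA -(addrA (prod _ _)) addrr2 addr0.
Qed.

Lemma homology_mulE x y : mul (hclass x) (hclass y) = hclass (prodz x y).
Proof. by rewrite /homology_mul -lock; apply: hclass_prodz; exact: hclass_repr. Qed.

Lemma hclass_connesz x x' : hclass x = hclass x' ->
  hclass (connesz x) = hclass (connesz x').
Proof.
move=> /hclass_eqP[c /= xc]; apply/hclass_eqP; exists (B c).
by rewrite /= hochD_connes -xc !subr2 (linD (@connes_linear A)).
Qed.

Lemma homology_connesE x : Delta (hclass x) = hclass (connesz x).
Proof. by rewrite /homology_connes -lock; apply: hclass_connesz; exact: hclass_repr. Qed.

Lemma hclass_val (z z' : cycle) : dcycle_val z = dcycle_val z' -> hclass z = hclass z'.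
Proof. by move=> e; congr hclass; apply: val_inj. Qed.

Lemma homology_mul_linearl q : linear (mul^~ q).
Proof.
move=> c p p'; have [[x ->] [x' ->] [y ->]] :=
  And3 (hclass_surj p) (hclass_surj p') (hclass_surj q).
rewrite -hclass_comb !homology_mulE -hclass_comb; apply: hclass_val.
rewrite [RHS](dcycle_val_comb c (prodz x y)) /=.
by rewrite [X in prod X _](dcycle_val_comb c x x') (proj1 pb).
Qed.

Lemma homology_mulC : commutative mul.
Proof.
move=> p q; have [[x ->] [y ->]] := conj (hclass_surj p) (hclass_surj q).
rewrite !homology_mulE; apply/hclass_eqP.
exists (ins (dcycle_val x) (dcycle_val y)); rewrite subr2 /= (hochD_ins Ecas) !dcycleK.
by rewrite (lin0 (proj1 ib _)) (lin0 (proj2 ib _)) !add0r.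
Qed.

Lemma homology_mul_linearr p : linear (mul p).
Proof. by move=> c q q'; rewrite !(homology_mulC p) homology_mul_linearl. Qed.

Lemma homology_mulA : associative mul.
Proof.
move=> p q r; have [[x ->] [y ->] [z ->]] :=
  And3 (hclass_surj p) (hclass_surj q) (hclass_surj r).
by rewrite !homology_mulE; apply: hclass_val; exact: prodA.
Qed.

Lemma homology_connes_linear : linear Delta.
Proof.
move=> c p q; have [[x ->] [y ->]] := conj (hclass_surj p) (hclass_surj q).
rewrite -hclass_comb !homology_connesE -hclass_comb; apply: hclass_val.
rewrite [RHS](dcycle_val_comb c (connesz x)) /=.
by rewrite [X in B X](dcycle_val_comb c x y) connes_linear.
Qed.

Lemma homology_connes2 p : Delta (Delta p) = 0.
Proof.
have [x ->] := hclass_surj p; rewrite !homology_connesE -hclass0; apply: hclass_val.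
by rewrite dcycle_val0; exact: connes2.
Qed.

Lemma hclassD (x y : cycle) : hclass (x + y) = hclass x + hclass y.
Proof. exact: (raddfD (to_modq _)). Qed.

Lemma dcycle_valD (x y : cycle) : dcycle_val (x + y) = dcycle_val x + dcycle_val y.
Proof. exact: (raddfD (val : cycle -> _)). Qed.

Lemma hclass_insz x y : hclass (insz x y) =
  Delta (mul (hclass x) (hclass y)) + mul (Delta (hclass x)) (hclass y)
  + mul (Delta (hclass y)) (hclass x).
Proof.
rewrite !homology_connesE !homology_mulE !homology_connesE -!hclassD; apply/hclass_eqP.
eexists; rewrite subr2 !dcycle_valD.
exact: connes_bracket_boundary (dcycleK x) (dcycleK y).
Qed.

Lemma hclass_insz_prod x y z : hclass (insz (prodz x y) z) =
  mul (hclass x) (hclass (insz y z)) + mul (hclass (insz x z)) (hclass y).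
Proof.
rewrite !homology_mulE -!hclassD; apply/hclass_eqP.
eexists; rewrite subr2 dcycle_valD.
exact: ins_prod_boundary (dcycleK x) (dcycleK y) (dcycleK z).
Qed.

(** This is the derivation rule for the bracket of a b with c, expanded. The term
    [mul (mul a b) (Delta c)] comes three times, once from each bracket, so it survives once. *)
Lemma homology_BV a b c : Delta (mul (mul a b) c) =
  mul (Delta (mul a b)) c + mul a (Delta (mul b c)) + mul b (Delta (mul a c))
  + mul (mul (Delta a) b) c + mul (mul a (Delta b)) c + mul (mul a b) (Delta c).
Proof.
have [[x ->] [y ->] [z ->]] := And3 (hclass_surj a) (hclass_surj b) (hclass_surj c).
have := hclass_insz_prod x y z; rewrite !hclass_insz -homology_mulE.
move: (hclass x) (hclass y) (hclass z) => {}a {}b {}c.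
rewrite !(linD (homology_mul_linearl _)) !(linD (homology_mul_linearr _)).
rewrite (homology_mulC (Delta c) (mul a b)) (homology_mulC (Delta (mul a c)) b).
rewrite !homology_mulA -(homology_mulA (Delta a) c) (homology_mulC c b) homology_mulA.
rewrite -(homology_mulA a (Delta c) b) (homology_mulC (Delta c) b) homology_mulA.
rewrite -(homology_mulA (Delta c) a b) (homology_mulC (Delta c) (mul a b)).
set t1 := Delta _; set t2 := mul (Delta _) _; set t3 := mul (mul a b) _ => e.
have -> : t1 = t1 + t2 + t3 + t2 + t3 by char2.
rewrite e; char2.
Qed.

End HomologyBV.

(** * Comparison with the coproduct, and the shifted grading *)

Section FrobeniusProduct.
Variables (A : comAlgType 'F_2) (m : int) (F : open_frobenius A m) (E : seq (A * A)).
Hypotheses (Ecas : casimir F E) (Ecop : coprod_by F E).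

Lemma rprod_wordE a s b t : rprod_word F a s b t = prod_word E a s b t.
Proof. by rewrite /rprod_word Ecop //; exact/bilin_cat/chainwise_rgen. Qed.

Lemma rprodE x y : rprod F x y = rlift2 (prod_word E) x y.
Proof.
have <- : rprod_word F = prod_word E by do 4!apply/funext => ?; exact: rprod_wordE.
by [].
Qed.

Lemma rprod_gr k l x y : rchains_gr F k x -> rchains_gr F l y ->
  rchains_gr F (k + l + m - 1) (rprod F x y).
Proof.
have [pl pr] := rlift2_bilin (prod_word_chainwise E).
move=> gx gy; rewrite rprodE; move: x gx; apply: rchains_gr_ind.
- by rewrite (lin0 (pl y)); exact: lspan_zero.
- by move=> c x x' gx gx'; rewrite (pl y); exact: rchains_gr_comb gx gx'.
move=> a s i ga gs; move: y gy; apply: rchains_gr_ind.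
- by rewrite (lin0 (pr (rgen a s))); exact: lspan_zero.
- by move=> c x x' gx gx'; rewrite (pr (rgen a s)); exact: rchains_gr_comb gx gx'.
move=> b t j gb gt.
have [->|s0] := eqVneq s [::]; first by rewrite rgen_nil (lin0 (pl _)); exact: lspan_zero.
have [->|t0] := eqVneq t [::]; first by rewrite rgen_nil (lin0 (pr _)); exact: lspan_zero.
rewrite rlift2_rgen //; last exact: prod_word_chainwise.
by rewrite -rprod_wordE; exact: (rprod_word_gr ga gs gb gt).
Qed.

(** The formulas differ only in the half of the Casimir element that absorbs [a] or [b]. *)
Lemma rprod_formulas a s b t : s != [::] -> t != [::] ->
  [/\ rprod F (rgen a s) (rgen b t)
        = coprod_sum F (a * b) (fun u v => rgen u (s ++ v :: t)),
      rprod F (rgen a s) (rgen b t)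
        = coprod_sum F a (fun u v => rgen u (s ++ (v * b) :: t))
    & rprod F (rgen a s) (rgen b t)
        = coprod_sum F b (fun u v => rgen (a * u) (s ++ v :: t))].
Proof.
move=> s0 t0; have wb := bilin_cat s t (chainwise_rgen A).
rewrite rprodE rlift2_rgen //; last exact: prod_word_chainwise.
split.
- by rewrite -rprod_wordE.
- rewrite Ecop; last first.
    split=> v; first exact: (proj1 wb).
    exact: linear_comp_fun (proj2 wb v) (linear_mulr b).
  by rewrite -(casimir_rotate Ecas a b wb) prod_wordE.
- rewrite Ecop; last exact: bilin_mull a wb.
  by apply: eq_bigr => p _; rewrite mulrA.
Qed.

Lemma homology_BV_algebra :
  BV_algebra (shift_gr (@HH_gr A F) (m - 1)) (homology_mul Ecas) (@homology_connes A F) (-1).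
Proof.
split.
- exact: shift_graded (homology_graded (rchains_graded F) (@hochD_gr A F)) _.
- exact: homology_mul_linearl.
- exact: homology_mul_linearr.
- move=> i j _ _ [x [gx ->]] [y [gy ->]]; rewrite homology_mulE.
  exists (prodz Ecas x y); split=> //=; rewrite -rprodE.
  (* With r = m - 1, the degree is (i - r) + (j - r) + r = (i + j) - r, so the shift makes the
     product of degree 0. *)
  by move: (rprod_gr gx gy); congr rchains_gr; lia.
- exact: homology_mulA.
- exact: homology_mulC.
- exact: homology_connes_linear.
- by right.
- move=> i _ [x [gx ->]]; rewrite homology_connesE; exists (connesz x); split=> //=.
  by move: (connes_gr gx); congr rchains_gr; lia.
- exact: homology_connes2.
- exact: homology_BV.
Qed.

End FrobeniusProduct.

Theorem theorem6p1 (A : comAlgType 'F_2) (m : int) (F : open_frobenius A m)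
    (F_sym : symmetric_frobenius F) :
  (forall (a0 : A) (s : seq A) (b0 : A) (t : seq A), s != [::] -> t != [::] ->
    [/\ rprod F (rgen a0 s) (rgen b0 t)
          = coprod_sum F (a0 * b0) (fun u v => rgen u (s ++ v :: t)),
        rprod F (rgen a0 s) (rgen b0 t)
          = coprod_sum F a0 (fun u v => rgen u (s ++ (v * b0) :: t))
      & rprod F (rgen a0 s) (rgen b0 t)
          = coprod_sum F b0 (fun u v => rgen (a0 * u) (s ++ v :: t))])
  /\ exists (mul : HH F -> HH F -> HH F) (Delta : HH F -> HH F),
    [/\ forall x y : dcycle (hochD F), exists z : dcycle (hochD F),
          dcycle_val z = rprod F (dcycle_val x) (dcycle_val y)
            /\ mul (hclass x) (hclass y) = hclass z,
        forall x : dcycle (hochD F), exists z : dcycle (hochD F),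
          dcycle_val z = connes (dcycle_val x) /\ Delta (hclass x) = hclass z
      & BV_algebra (shift_gr (@HH_gr A F) (m - 1)) mul Delta (-1)].
Proof.
have [E [Ecas Ecop]] := coprod_casimir F_sym.
split; first by move=> a s b t; exact: (rprod_formulas Ecas Ecop).
exists (homology_mul Ecas), (@homology_connes A F); split=> [x y|x|].
- by exists (prodz Ecas x y); rewrite homology_mulE (rprodE Ecop).
- by exists (connesz x); rewrite homology_connesE.
- exact: homology_BV_algebra.
Qed.
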